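(* Let $\mathbb{T}$ be an unbounded above time scale that is periodic in shifts $\delta_\pm$ (associated with an initial point $t_0\in\mathbb{T}^*$) with period $P\in(t_0,+\infty)_{\mathbb{T}^*}$, let $T\in(P,+\infty)_{\mathbb{T}^*}$, let $\gamma\in\mathbb{R}$, let $D'\subset D\subset\mathbb{R}^n$, $x_0\in D'$, $Q=\{(t,x): t\in\mathbb{T},\ x\in D\}$, and let $X:Q\to\mathbb{R}^n$. Write $\delta^{(i)}(t_0)$ for the $i$-fold composition of $\delta_+(T,\cdot)$ applied to $t_0$ (with $\delta^{(0)}(t_0)=t_0$). For a small parameter $\varepsilon>0$ let $x(t)$ denote the solution of $$x^{\Delta}=\varepsilon X(t,x),\qquad x(t_0)=x_0,$$ and let $\xi(t)$ denote the solution of the averaged system $$\xi^{\Delta}=\varepsilon\widehat X(t,\xi),\qquad \xi(t_0)=x_0,$$ where $$\widehat X(t,x)=\widehat X_i(x)=\frac{\gamma^i}{\delta^{(i+1)}(t_0)-\delta^{(i)}(t_0)}\int_{t_0}^{\delta_+(T,t_0)}X(s,x)\,\Delta s\quad\text{for }\delta^{(i)}(t_0)\le t<\delta^{(i+1)}(t_0),\ i=0,1,2,\dots$$ Suppose the following conditions hold in $Q$: 1) every component of $X(t,x)$ is, for each fixed $x$, a geometric $\Delta$-quasiperiodic function of $t$ with period $T$ and factor $\gamma$; 2) $X(t,x)$ is rd-continuous with respect to $t$ and regressive; $X$ satisfies conditions of existence and uniqueness of the solution of the Cauchy problem; there is $M>0$ with $\|X(t,x)\|\le M$ for all $(t,x)\in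 Q$; and there is $\lambda>0$ with $\|X(t,x_1)-X(t,x_2)\|\le\lambda\|x_1-x_2\|$ for all $(t,x_1),(t,x_2)\in Q$; 3) there exists a constant $K>0$ such that $\delta^{(i+1)}(t_0)-\delta^{(i)}(t_0)\le K$ for all $i\ge1$; 4) there are $\bar\varepsilon>0$ and $\rho>0$ such that, for every $\varepsilon\in(0,\bar\varepsilon]$, the solution $\xi(t)$ of the averaged system with $\xi(t_0)=x_0\in D'$ is well defined for all $t\in\mathbb{T}^\kappa$ and lies in $D$ together with its $\rho$-neighbourhood. Then for any $L>0$ there exist $\varepsilon_0=\varepsilon_0(L)>0$ and a constant $C>0$ (independent of $\varepsilon$ and $t$) such that for all $0<\varepsilon<\varepsilon_0$ and all $t\in[t_0,t_0+L\varepsilon^{-1}]\cap\mathbb{T}$ $$\|x(t)-\xi(t)\|\le C\varepsilon.$$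
   Context: A time scale $\mathbb{T}$ is a nonempty closed subset of $\mathbb{R}$. Standard time scale calculus is used: forward jump $\sigma(t)=\inf\{s\in\mathbb{T}:s>t\}$, graininess $\mu(t)=\sigma(t)-t$, $\mathbb{T}^\kappa=\mathbb{T}$ with its maximum removed if that maximum exists and is left-scattered, and $\mathbb{T}^\kappa=\mathbb{T}$ otherwise; $f^\Delta$ is the $\Delta$-derivative ($|f(\sigma(t))-f(s)-f^\Delta(t)(\sigma(t)-s)|\le\epsilon|\sigma(t)-s|$ for $s$ in a neighbourhood of $t$ in $\mathbb{T}$ depending on $\epsilon>0$), and $\int\cdot\,\Delta s$ the $\Delta$-integral. A function is rd-continuous if it is continuous at right-dense points and has finite left limits at left-dense points. $X$ is regressive if for every $t\in\mathbb{T}^\kappa$ the map $x\mapsto x+\mu(t)X(t,x)$ is invertible. For a set $S\subset\mathbb{R}$, $[a,b)_S=[a,b)\cap S$, and similarly for other intervals. Shift operators. Let $\mathbb{T}^*\subset\mathbb{T}$ be a nonempty subset containing a fixed point $t_0$. The shift operators $\delta_\pm:[t_0,\infty)_{\mathbb{T}}\times\mathbb{T}^*\to\mathbb{T}^*$ (partially defined), with domains $D_\pm=\{(s,t)\in[t_0,\infty)_{\mathbb{T}}\times\mathbb{T}^*:\delta_\pm(s,t)\in\mathbb{T}^*\}$, satisfy: (P1) each $\delta_\pm(s,\cdot)$ is strictly increasing on its domain; (P2) $\delta_+(\cdot,u)$ is strictly increasing and $\delta_-(\cdot,u)$ is strictly decreasing; (P3) for $t\in[t_0,\infty)_{\mathbb{T}}$,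 $(t,t_0)\in D_+$ and $\delta_+(t,t_0)=t$; for $t\in\mathbb{T}^*$, $(t_0,t)\in D_+$ and $\delta_+(t_0,t)=t$; (P4) if $(s,t)\in D_\pm$, then $(s,\delta_\pm(s,t))\in D_\mp$ and $\delta_\mp(s,\delta_\pm(s,t))=t$; (P5) if $(s,t)\in D_\pm$ and $(u,\delta_\pm(s,t))\in D_\mp$, then $(s,\delta_\mp(u,t))\in D_\pm$ and $\delta_\mp(u,\delta_\pm(s,t))=\delta_\pm(s,\delta_\mp(u,t))$. $\mathbb{T}$ is periodic in shifts $\delta_\pm$ if there is $p\in(t_0,\infty)_{\mathbb{T}^*}$ with $(p,t)\in D_\mp$ (i.e. in both $D_-$ and $D_+$) for all $t\in\mathbb{T}^*$; if the infimum $P$ of all such $p$ is different from $t_0$, then $P$ is called the period of $\mathbb{T}$. A function $f$ is geometric $\Delta$-quasiperiodic with period $T>P$ and factor $\gamma$ if $(T,t)\in D_\pm$ for all $t\in\mathbb{T}^*$ (so that all shifts by $T$ are defined), $\delta_+(T,\cdot)$ is $\Delta$-differentiable with derivative $\delta_+^\Delta(T,t)$ (with respect to $t$), and $f(\delta_+(T,t))\,\delta_+^\Delta(T,t)=\gamma f(t)$ for all $t\in\mathbb{T}^*$. *)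

(* Defs.v *)
From HB Require Import structures.
From mathcomp Require Import all_boot all_order all_algebra.
From mathcomp Require Import all_classical all_reals all_analysis.

Set Implicit Arguments.
Unset Strict Implicit.
Unset Printing Implicit Defensive.

Import Order.TTheory GRing.Theory Num.Theory.
Import numFieldNormedType.Exports.

Local Open Scope classical_set_scope.
Local Open Scope ring_scope.

Section TimeScales.
Context {R : realType}.
Implicit Types (TS A J : set R) (t d : R).

Definition time_scale TS : Prop := closed TS /\ TS !=set0.

Definition ts_itv TS (a b : R) : set R := [set t | TS t /\ a <= t <= b].

(* The conventions inf {} = sup TS and sup {} = inf TS of time scale calculus
   are built in: the jumps fix the extremal points of TS. *)
Definition fjump TS t : R :=
  if `[< exists s, TS s /\ t < s >] then inf [set s | TS s /\ t < s] else t.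

Definition bjump TS t : R :=
  if `[< exists s, TS s /\ s < t >] then sup [set s | TS s /\ s < t] else t.

Definition graininess TS t : R := fjump TS t - t.

Definition right_dense TS t : Prop :=
  (exists s, TS s /\ t < s) /\ fjump TS t = t.

Definition left_dense TS t : Prop :=
  (exists s, TS s /\ s < t) /\ bjump TS t = t.

Definition ts_kappa TS : set R :=
  [set t | TS t /\ ~ ((forall s, TS s -> s <= t) /\ bjump TS t < t)].

(* [is_delta_deriv TS A f t d]: the function f, whose domain of definition is
   A `<=` TS (values outside A are irrelevant), has Delta-derivative d at t.
   The jump is that of TS; as f (fjump TS t) occurs in the definition, the
   jump of t has to lie in A.  The usual notion is the case A = TS. *)
Definition is_delta_deriv {V : normedModType R} TS A (f : R -> V) t (d : V) :
    Prop :=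
  [/\ ts_kappa TS t, A t, A (fjump TS t) &
      forall e : R, 0 < e -> \forall s \near t, A s ->
        `|f (fjump TS t) - f s - (fjump TS t - s) *: d|
          <= e * `|fjump TS t - s| ].

Definition is_antideriv {V : normedModType R} TS (f F : R -> V) : Prop :=
  forall t, ts_kappa TS t -> is_delta_deriv TS TS F t (f t).

(* Cauchy Delta-integral: F b - F a for an antiderivative F of f on TS.  An
   antiderivative exists when f is rd-continuous; the value is unspecified if
   there is none. *)
Definition delta_int {V : normedModType R} TS (a b : R) (f : R -> V) : V :=
  let F := get [set F : R -> V | is_antideriv TS f F] in F b - F a.

Definition rd_continuous {V : normedModType R} TS (f : R -> V) : Prop :=
  (forall t, TS t -> right_dense TS t -> f s @[s --> within TS (nbhs t)] --> f t)
  /\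
  (forall t, TS t -> left_dense TS t ->
     exists l : V, f s @[s --> within [set s | TS s /\ s < t] (nbhs t)] --> l).

(* x |-> x + mu(t) X(t, x) is defined on D only; invertible means invertible
   as a map from D onto its image. *)
Definition regressive {V : normedModType R} TS (D : set V) (X : R -> V -> V) :
    Prop :=
  forall t, ts_kappa TS t ->
    let g := fun x => x + graininess TS t *: X t x in set_bij D (g @` D) g.

(* [is_solution TS J D F y]: y solves y^Delta = F(t, y) on the interval J of
   TS, where F(t, _) is defined on D.  As F(t, y(t)) governs y from t
   onwards, nothing is required at the maximum of J (if any) but continuity.
   Derivatives are relative to J, hence one-sided at min J. *)
Definition is_solution {V : normedModType R} TS J (D : set V)
    (F : R -> V -> V) (y : R -> V) : Prop :=
  {within J, continuous y} /\
  (forall t, J t -> (exists s, J s /\ t < s) ->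
     D (y t) /\ is_delta_deriv TS J y t (F t (y t))).

(* Local existence to the right, and uniqueness, for y^Delta = F(t, y) with
   data y(tau) = eta, tau >= t0 and eta in the interior of D. *)
Definition cauchy_well_posed {V : normedModType R} TS (t0 : R) (D : set V)
    (F : R -> V -> V) : Prop :=
  forall tau eta, TS tau -> t0 <= tau -> (interior D) eta ->
    (exists b (y : R -> V),
       [/\ TS b, tau < b, y tau = eta & is_solution TS (ts_itv TS tau b) D F y])
    /\
    (forall b (y z : R -> V), TS b -> tau < b -> y tau = eta -> z tau = eta ->
       is_solution TS (ts_itv TS tau b) D F y ->
       is_solution TS (ts_itv TS tau b) D F z ->
       forall t, ts_itv TS tau b t -> y t = z t).

End TimeScales.

Section Shifts.
Context {R : realType}.

(* dp, dm are the shifts delta_+, delta_- as total functions; they are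
   meaningful only on their domains: [Dp s t] stands for (s, t) \in D_+ and
   [Dm s t] for (s, t) \in D_-. *)
Record shift_operators (TS Ts : set R) (t0 : R) (dp dm : R -> R -> R)
    (Dp Dm : R -> R -> Prop) : Prop := ShiftOperators {
  shift_subset : Ts `<=` TS;
  shift_origin : Ts t0;
  shift_domp : forall s t, Dp s t -> [/\ TS s, t0 <= s, Ts t & Ts (dp s t)];
  shift_domm : forall s t, Dm s t -> [/\ TS s, t0 <= s, Ts t & Ts (dm s t)];
  shift_P1p : forall s t u, Dp s t -> Dp s u -> t < u -> dp s t < dp s u;
  shift_P1m : forall s t u, Dm s t -> Dm s u -> t < u -> dm s t < dm s u;
  shift_P2p : forall s r u, Dp s u -> Dp r u -> s < r -> dp s u < dp r u;
  shift_P2m : forall s r u, Dm s u -> Dm r u -> s < r -> dm r u < dm s u;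
  shift_P3r : forall t, TS t -> t0 <= t -> Dp t t0 /\ dp t t0 = t;
  shift_P3l : forall t, Ts t -> Dp t0 t /\ dp t0 t = t;
  shift_P4p : forall s t, Dp s t -> Dm s (dp s t) /\ dm s (dp s t) = t;
  shift_P4m : forall s t, Dm s t -> Dp s (dm s t) /\ dp s (dm s t) = t;
  shift_P5p : forall s t u, Dp s t -> Dm u (dp s t) ->
    [/\ Dm u t, Dp s (dm u t) & dm u (dp s t) = dp s (dm u t)];
  shift_P5m : forall s t u, Dm s t -> Dp u (dm s t) ->
    [/\ Dp u t, Dm s (dp u t) & dp u (dm s t) = dm s (dp u t)]
}.

Definition shift_periods (Ts : set R) (t0 : R) (Dp Dm : R -> R -> Prop) :
    set R :=
  [set p | [/\ Ts p, t0 < p & forall t, Ts t -> Dm p t /\ Dp p t]].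

Definition periodic_in_shifts (Ts : set R) (t0 : R) (Dp Dm : R -> R -> Prop) :
    Prop := shift_periods Ts t0 Dp Dm !=set0.

Definition is_shift_period (Ts : set R) (t0 : R) (Dp Dm : R -> R -> Prop)
    (P : R) : Prop :=
  P = inf (shift_periods Ts t0 Dp Dm) /\ P <> t0.

Definition geom_quasiperiodic (TS Ts : set R) (dp : R -> R -> R)
    (Dp Dm : R -> R -> Prop) (T gamma : R) (f : R -> R) : Prop :=
  (forall t, Ts t -> Dp T t /\ Dm T t) /\
  (exists dT : R -> R, forall t, Ts t ->
     is_delta_deriv TS Ts (dp T) t (dT t) /\ f (dp T t) * dT t = gamma * f t).

Definition shift_iter (dp : R -> R -> R) (T t0 : R) (i : nat) : R :=
  iter i (dp T) t0.

(* The value of the averaged right-hand side on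
   [shift_iter i, shift_iter i.+1). *)
Definition avg_field {V : normedModType R} (TS : set R) (dp : R -> R -> R)
    (T t0 gamma : R) (X : R -> V -> V) (i : nat) (x : V) : V :=
  (gamma ^+ i / (shift_iter dp T t0 i.+1 - shift_iter dp T t0 i))
    *: delta_int TS t0 (dp T t0) (fun s => X s x).

(* The averaged right-hand side jumps at the times shift_iter i, where a
   solution may have a corner if the point is dense; so the equation is
   imposed on each closed piece, with derivatives relative to that piece.
   Continuity on the closed pieces makes xi continuous on [t0, oo). *)
Definition is_avg_solution {V : normedModType R} (TS : set R)
    (dp : R -> R -> R) (T t0 gamma eps : R) (D : set V) (X : R -> V -> V)
    (xi : R -> V) : Prop :=
  forall i : nat,
    is_solution TS
      (ts_itv TS (shift_iter dp T t0 i) (shift_iter dp T t0 i.+1)) D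
      (fun _ x => eps *: avg_field TS dp T t0 gamma X i x) xi.

End Shifts.

(* Main.v *)
Require Import Defs.
From HB Require Import structures.
From mathcomp Require Import all_boot all_order all_algebra.
From mathcomp Require Import all_classical all_reals all_analysis.
From mathcomp Require Import ring lra.

Import Order.TTheory GRing.Theory Num.Theory.
Import numFieldNormedType.Exports.

Local Open Scope classical_set_scope.
Local Open Scope ring_scope.

Set Implicit Arguments.
Unset Strict Implicit.
Unset Printing Implicit Defensive.

(** Write tau_i for the i-fold shift of t0 by T and h_i = tau_(i+1) - tau_i.

    The shift by T is an order isomorphism of T*, which contains all points of
    the time scale from t0 on; therefore it commutes with the forward jump
    ([shift_fjump]), obeys a chain rule ([shift_chain_rule]), and its iterates
    tau_i are unbounded ([shift_iter_unbounded]). Quasiperiodicity then says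
    that the integral of X(., x) over [tau_i, tau_(i+1)] is gamma ^+ i times
    the integral over the first step. So the averaged field on the i-th step is
    the mean of X over that step ([avg_field_mean]): it inherits the bound M
    and the Lipschitz constant lambda of X, uniformly in i and for any gamma.
    This uses that X(., x) has an antiderivative ([ex_antideriv]).

    Let K bound all h_i. On a step both x and xi move by at most eps M K. Hence
    x - xi, from which one subtracts eps times the integral of
    X(., xi(tau_i)) minus its mean, has a derivative of norm at most
    eps lambda (e_i + 2 eps M K), where e_i is the norm of the error at tau_i,
    and what is subtracted vanishes at both ends of the step. By the mean value
    inequality [delta_mvt],
      e_(i+1) <= e_i + eps lambda h_i (e_i + 2 eps M K)
    ([step_error]), so
      e_i + 2 eps M K <= exp (eps lambda (tau_i - t0)) 2 eps M K
    ([error_at_steps]). On [t0, t0 + L / eps] the error is therefore at most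
    C eps with C = 2 M K exp (lambda L) ([averaging_estimate]).

    The estimate holds for a solution on any initial interval. For C eps < rho
    it keeps x in the interior of D, so that local well-posedness continues x
    up to t0 + L / eps ([ex_solution]). At a point where two solutions are glued
    the equation must hold from the left as well; this comes from the continuity
    of X in t at right-dense points ([solution_left_deriv]). *)

(** * Forward jumps in a time scale unbounded above *)

Section TimeScaleBasics.
Context {R : realType} (TS : set R).
Hypothesis closedTS : closed TS.
Hypothesis unboundedTS : ~ has_ubound TS.
Implicit Types s t a b : R.

Lemma ts_exists_gt t : exists2 s, TS s & t < s.
Proof. by have /has_ubPn := unboundedTS; exact. Qed.

Lemma fjumpE t : fjump TS t = inf [set s | TS s /\ t < s].
Proof.
rewrite /fjump; case: asboolP => // nex; have [s Ts ts] := ts_exists_gt t.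
by case: nex; exists s.
Qed.

Lemma fjump_has_inf t : has_inf [set s | TS s /\ t < s].
Proof.
split; first by have [s Ts ts] := ts_exists_gt t; exists s.
by exists t => s [_ /ltW].
Qed.

Lemma fjump_ge t : t <= fjump TS t.
Proof.
rewrite fjumpE; apply: lb_le_inf => [|s [_ /ltW//]].
by case: (fjump_has_inf t).
Qed.

Lemma fjump_le t s : TS s -> t < s -> fjump TS t <= s.
Proof. by move=> Ts ts; rewrite fjumpE ge_inf//; case: (fjump_has_inf t). Qed.

Lemma le_fjump t m : (forall s, TS s -> t < s -> m <= s) -> m <= fjump TS t.
Proof.
move=> lbm; rewrite fjumpE; apply: lb_le_inf => [|s [Ts ts]]; last exact: lbm.
by case: (fjump_has_inf t).
Qed.

Lemma fjump_adherent t m : fjump TS t < m -> exists2 s, TS s & t < s < m.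
Proof.
move=> jm; have /inf_adherent/(_ (fjump_has_inf t)) : 0 < m - fjump TS t.
  by rewrite subr_gt0.
by move=> [s [Ts ts]]; rewrite -fjumpE addrC subrK => sm; exists s; rewrite ?ts.
Qed.

Lemma fjump_in t : TS (fjump TS t).
Proof.
apply: closedTS => B /nbhs_ballP[r r0 rB].
have [|s Ts /andP[ts sr]] := @fjump_adherent t (fjump TS t + r).
  by rewrite ltrDl.
exists s; split => //; apply: rB; rewrite -ball_normE /=.
by have := fjump_le Ts ts; rewrite ltr_norml; lra.
Qed.

Lemma fjump_itv a b s t : ts_itv TS a b t -> ts_itv TS a b s -> t < s ->
  ts_itv TS a b (fjump TS t).
Proof.
move=> [_ /andP[at_ _]] [Ts /andP[_ sb]] ts; split; first exact: fjump_in.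
by rewrite (le_trans at_ (fjump_ge t)) (le_trans (fjump_le Ts ts)).
Qed.

Lemma ts_kappa_unbounded t : TS t -> ts_kappa TS t.
Proof.
move=> Tt; split=> // -[tmax _]; have [s Ts] := ts_exists_gt t.
by rewrite ltNge tmax.
Qed.

Lemma closed_bounded_sup (S : set R) : S `<=` TS -> has_sup S -> TS (sup S).
Proof.
move=> STS hS; apply: closedTS => B /nbhs_ballP[r r0 rB].
have [s Ss sr] := sup_adherent r0 hS.
exists s; split; first exact: STS.
apply: rB; rewrite -ball_normE /=; have := ub_le_sup hS.2 Ss.
by rewrite ltr_norml; lra.
Qed.

End TimeScaleBasics.

(** * Delta derivatives and the mean value inequality *)

Section DeltaDerivative.
Context {R : realType} {V : normedModType R}.
Implicit Types (TS A J : set R) (f g : R -> V) (s t : R) (d : V).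

Lemma is_delta_derivP TS A f t d :
  is_delta_deriv TS A f t d <->
  [/\ ts_kappa TS t, A t, A (fjump TS t) &
      forall e : R, 0 < e -> exists2 r, 0 < r & forall s, A s -> `|t - s| < r ->
        `|f (fjump TS t) - f s - (fjump TS t - s) *: d|
          <= e * `|fjump TS t - s| ].
Proof.
split=> -[kt At Aj fd]; split=> // e e0.
  have /nbhs_ballP[r r0 rB] := fd e e0.
  by exists r => // s As ts; apply: (rB s) => //; rewrite -ball_normE.
have [r r0 rB] := fd e e0; apply/nbhs_ballP; exists r => //= s.
by rewrite -ball_normE => /= ts As; exact: rB.
Qed.

(** A derivative only depends on the values near t and at the jump of t. This
    transfers derivatives to functions pieced together from several
    solutions. *)
Lemma is_delta_deriv_local {TS A B f g t d} {r : R} : 0 < r ->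
  is_delta_deriv TS A f t d -> B t -> B (fjump TS t) ->
  g (fjump TS t) = f (fjump TS t) ->
  (forall s, B s -> `|t - s| < r -> A s /\ g s = f s) ->
  is_delta_deriv TS B g t d.
Proof.
move=> r0 /is_delta_derivP[kt At Aj fd] Bt Bj gj gf.
apply/is_delta_derivP; split => // e /fd[r' r'0 fr'].
exists (Num.min r r'); first by rewrite lt_min r0.
move=> s Bs; rewrite lt_min => /andP[sr sr']; have [As ->] := gf s Bs sr.
by rewrite gj; exact: fr'.
Qed.

Lemma is_delta_deriv_sub {TS A B f t d} : B `<=` A -> B t -> B (fjump TS t) ->
  is_delta_deriv TS A f t d -> is_delta_deriv TS B f t d.
Proof.
move=> BA Bt Bj /(is_delta_deriv_local (@ltr01 R))/(_ Bt Bj erefl); apply.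
by move=> s /BA As _; split.
Qed.

Lemma is_delta_derivD TS A f g t d e : is_delta_deriv TS A f t d ->
  is_delta_deriv TS A g t e ->
  is_delta_deriv TS A (fun s => f s + g s) t (d + e).
Proof.
move=> /is_delta_derivP[kt At Aj fd] /is_delta_derivP[_ _ _ ge].
apply/is_delta_derivP; split => // z z0.
have z2 : 0 < z / 2 by lra.
have [r r0 fr] := fd _ z2; have [r' r'0 gr] := ge _ z2.
exists (Num.min r r'); first by rewrite lt_min r0.
move=> s As; rewrite lt_min => /andP[/(fr s As) ds /(gr s As) es].
rewrite scalerDr (opprD (f s)) (addrACA (f _)) opprD (addrACA (_ - _)).
rewrite (le_trans (ler_normD _ _))// [z]splitr mulrDl.
by apply: lerD; [exact: ds | exact: es].
Qed.

Lemma is_delta_derivZ TS A f t d (k : R) : is_delta_deriv TS A f t d ->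
  is_delta_deriv TS A (fun s => k *: f s) t (k *: d).
Proof.
move=> /is_delta_derivP[kt At Aj fd].
apply/is_delta_derivP; split => // z z0.
have z2 : 0 < z / (`|k| + 1) by rewrite divr_gt0// ltr_wpDl.
have [r r0 fr] := fd _ z2; exists r => // s As ts.
rewrite scalerA mulrC -scalerA -!scalerBr normrZ.
apply: (@le_trans _ _ (`|k| * (z / (`|k| + 1) * `|fjump TS t - s|))).
  by apply: ler_wpM2l => //; exact: fr.
rewrite mulrA; apply: ler_wpM2r => //.
rewrite mulrCA ger_pMr// ler_pdivrMr ?ltr_wpDl// mul1r; lra.
Qed.

Lemma is_delta_deriv_cst TS A t d : ts_kappa TS t -> A t -> A (fjump TS t) ->
  is_delta_deriv TS A (fun=> d) t 0.
Proof.
move=> kt At Aj; apply/is_delta_derivP; split => // e e0; exists 1 => // s _ _.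
by rewrite subrr scaler0 subr0 normr0 mulr_ge0// ltW.
Qed.

Lemma is_delta_deriv_linear TS A t d :
  ts_kappa TS t -> A t -> A (fjump TS t) ->
  is_delta_deriv TS A (fun s => s *: d) t d.
Proof.
move=> kt At Aj; apply/is_delta_derivP; split => // e e0; exists 1 => // s _ _.
by rewrite -scalerBl subrr normr0 mulr_ge0// ltW.
Qed.

(** Taking s = t in the definition, with arbitrary e, makes the difference
    quotient over the gap exact. *)
Lemma delta_deriv_jump TS A f t d : is_delta_deriv TS A f t d ->
  f (fjump TS t) - f t = (fjump TS t - t) *: d.
Proof.
move=> /is_delta_derivP[kt At Aj fd].
apply/eqP; rewrite -subr_eq0 -normr_le0; apply/ler_addgt0Pr => e e0.
have h0 : 0 < `|fjump TS t - t| + 1 by rewrite ltr_wpDl.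
have [r r0 /(_ t At)] := fd _ (divr_gt0 e0 h0).
rewrite subrr normr0 => /(_ r0) /le_trans; apply.
by rewrite add0r mulrAC ler_pdivrMr// ler_pM2l//; lra.
Qed.

Lemma within_cvgP A f t d : f s @[s --> within A (nbhs t)] --> d <->
  forall e : R, 0 < e ->
    exists2 r, 0 < r & forall s, A s -> `|t - s| < r -> `|d - f s| <= e.
Proof.
split=> [/cvgrPdist_le fd e e0|fd].
  have := fd e e0; rewrite near_withinE => /nbhs_ballP[r r0 rB].
  by exists r => // s As ts; apply: (rB s) => //; rewrite -ball_normE.
apply/cvgrPdist_le => e /fd[r r0 fr]; rewrite near_withinE.
by apply/nbhs_ballP; exists r => //= s; rewrite -ball_normE => ts As; exact: fr.
Qed.

Lemma within_continuousP A f : {within A, continuous f} <->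
  forall t, A t -> f s @[s --> within A (nbhs t)] --> f t.
Proof. exact: subspace_continuousP. Qed.

Lemma delta_deriv_continuous TS A f t d : is_delta_deriv TS A f t d ->
  f s @[s --> within A (nbhs t)] --> f t.
Proof.
move=> fd; have jumpE := delta_deriv_jump fd.
have /is_delta_derivP[kt At Aj {}fd] := fd.
apply/within_cvgP => e e0; set j := fjump TS t in jumpE fd.
have h0 : 0 < `|j - t| + 1 by rewrite ltr_wpDl.
have d0 : 0 < `|d| + 1 by rewrite ltr_wpDl.
have e2 : 0 < e / 2 by lra.
have [r r0 fr] := fd _ (divr_gt0 e2 h0).
have e2d := divr_gt0 e2 d0.
exists (Num.min r (Num.min 1 (e / 2 / (`|d| + 1)))).
  by rewrite !lt_min r0 ltr01.
move=> s As; rewrite !lt_min => /and3P[sr s1 sd].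
have -> : f t - f s = (f j - f s - (j - s) *: d) + (t - s) *: d.
  rewrite -[f j](subrK (f t)) jumpE [_ + f t]addrC (addrAC (f t)) -!addrA.
  congr (_ + _); rewrite -{1}[- f s]addr0; congr (_ + _).
  rewrite -scaleNr -!scalerDl.
  by rewrite (_ : j - t + _ = 0) ?scale0r//; ring.
rewrite (le_trans (ler_normD _ _))// [e]splitr lerD//.
  apply: le_trans (fr s As sr) _; rewrite mulrAC ler_pdivrMr// ler_pM2l//.
  by rewrite -(subrKA t) (le_trans (ler_normD _ _))// lerD2l ltW.
rewrite normrZ (le_trans (ler_wpM2l (normr_ge0 _) (_ : _ <= `|d| + 1)))//.
  by rewrite lerDl.
by rewrite -ler_pdivlMr// ltW.
Qed.

(** The mean value inequality, from which every estimate below is derived.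
    The set of points t where f has moved by at most
    (c + e) * (t - a) is closed, and at a point t < b of it the derivative
    provides another such point to the right of t: the jump of t if t is
    right-scattered, any point close to t otherwise.  So its supremum is b. *)
Lemma delta_mvt TS a b c f (d : R -> V) : closed TS -> ~ has_ubound TS ->
    TS a -> TS b -> a <= b -> {within ts_itv TS a b, continuous f} ->
    (forall t, ts_itv TS a b t -> t < b ->
       is_delta_deriv TS (ts_itv TS a b) f t (d t) /\ `|d t| <= c) ->
  `|f b - f a| <= c * (b - a).
Proof.
move=> cTS uTS Ta Tb ab /within_continuousP cf fd.
suff H e : 0 < e -> `|f b - f a| <= (c + e) * (b - a).
  apply/ler_addgt0Pr => e e0; have h0 : 0 < b - a + 1 by lra.
  have /le_trans -> // := H _ (divr_gt0 e0 h0).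
  rewrite mulrDl lerD2l mulrAC ler_pdivrMr// ler_pM2l//; lra.
move=> e0.
pose S := [set t | ts_itv TS a b t /\ `|f t - f a| <= (c + e) * (t - a)].
have Sa : S a by split; [split; rewrite ?lexx | rewrite !subrr normr0 mulr0].
have hS : has_sup S by split; [exists a | exists b => t [[_ /andP[]]]].
pose u := sup S; have ub t : S t -> t <= u by move=> St; apply: ub_le_sup => //; exact: hS.2.
have Ju : ts_itv TS a b u.
  split; first by apply: closed_bounded_sup => // t [[]].
  by rewrite ub//= ge_sup// => [|t [[_ /andP[]]]]; first by exists a.
have Su : S u.
  split=> //; apply/ler_addgt0Pr => z z0.
  have z2 : 0 < z / 2 by lra.
  have c0 : 0 < `|c + e| + 1 by rewrite ltr_wpDl.
  have /within_cvgP/(_ _ z2)[r r0 fr] := cf u Ju.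
  have [|t [Jt ft] tu] := @sup_adherent _ S (Num.min r (z / 2 / (`|c + e| + 1))) _ hS.
    by rewrite lt_min r0 divr_gt0.
  have tu' := ub t (conj Jt ft).
  have : u - t < Num.min r (z / 2 / (`|c + e| + 1)) by move: tu; rewrite -/u; lra.
  rewrite lt_min => /andP[utr]; rewrite ltr_pdivlMr// => utz.
  have futz : `|f u - f t| <= z / 2 by apply: fr => //; rewrite ger0_norm ?subr_ge0.
  rewrite -(subrKA (f t)) (le_trans (ler_normD _ _))//.
  have : - ((c + e) * (u - t)) <= z / 2.
    rewrite -mulNr (@le_trans _ _ (`|c + e| * (u - t)))//.
      by rewrite ler_wpM2r ?subr_ge0// -normrN ler_norm.
    by move: utz; rewrite mulrC mulrDl; nra.
  nra.
move: (Su) => [_ fu].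
have := Ju.2 => /andP[au]; rewrite le_eqVlt => /predU1P[<-//|ltub].
have step s : ts_itv TS a b s -> u < s -> ~ `|f s - f u| <= (c + e) * (s - u).
  move=> Js us fs; suff /ub : S s by rewrite leNgt us.
  split=> //; rewrite -(subrKA (f u)) (le_trans (ler_normD _ _))//.
  by rewrite -[s - a](subrKA u) mulrDr lerD.
have [du dc] := fd u Ju ltub.
have := fjump_ge uTS u; rewrite le_eqVlt => /predU1P[ju|ju]; last first.
  have Jb : ts_itv TS a b b by split; rewrite ?ab ?lexx.
  case: (step _ (fjump_itv cTS uTS Ju Jb ltub)) => //.
  rewrite (delta_deriv_jump du) normrZ gtr0_norm ?subr_gt0// mulrC.
  by rewrite ler_wpM2r ?subr_ge0 ?(ltW ju)//; lra.
have /is_delta_derivP[_ _ _ /(_ e e0)[r r0]] := du.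
rewrite -ju => fr.
have [|s Ts /andP[us]] := @fjump_adherent _ _ uTS u (Num.min (u + r) b).
  by rewrite -ju lt_min ltub ltrDl r0.
rewrite lt_min => /andP[sr sb].
have Js : ts_itv TS a b s by split; rewrite ?(ltW sb) ?(le_trans au)// ltW.
have us' : `|u - s| = s - u by rewrite distrC gtr0_norm ?subr_gt0.
have {}fr := fr s Js; rewrite us' in fr.
case: (step s Js us).
rewrite distrC -[f u - f s](subrK ((u - s) *: d u)).
rewrite (le_trans (ler_normD _ _))// addrC mulrDl lerD//.
  by rewrite normrZ us' mulrC ler_wpM2r// subr_ge0 ltW.
by apply: fr; lra.
Qed.

End DeltaDerivative.

(** * Existence of antiderivatives *)

Section UpperIntegral.
Context {R : realType} (TS : set R) (f : R -> R) (B : R).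
Hypothesis f_bounded : forall t, TS t -> `|f t| <= B.
Implicit Types (a b c m s t u v p : R) (G H : R -> R).

(** The increments of these functions are bounded by all upper Darboux sums, so
    that [upper_int] is the upper Darboux integral. No partition is needed to
    define it this way, and an upper integral suffices: additivity together
    with the bounds by the values of f gives the derivative wherever f is
    continuous, integrable or not. *)
Definition subprimitive G := forall u v c, TS u -> TS v -> u <= v ->
  (forall s, TS s -> u <= s < v -> f s <= c) -> G v - G u <= c * (v - u).

Definition upper_int a b := sup [set G b - G a | G in subprimitive].

Let lowerB t : TS t -> - B <= f t.
Proof. by move=> /f_bounded; rewrite ler_norml => /andP[]. Qed.

Let upperB t : TS t -> f t <= B.
Proof. by move=> /f_bounded; rewrite ler_norml => /andP[]. Qed.

(** Slope m on [a, b] and slope -B elsewhere: the subprimitive through which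
    a lower bound m of f on [a, b) bounds the upper integral from below. *)
Lemma subprimitive_slope a b m : TS a -> a <= b ->
  (forall s, TS s -> a <= s < b -> m <= f s) ->
  exists2 G, subprimitive G & G b - G a = m * (b - a).
Proof.
move=> Ta ab mf.
exists (fun t => - B * t + (m + B) * (Num.max a (Num.min t b) - a)); last first.
  rewrite minxx (min_l ab) (max_r ab) maxxx; ring.
move=> u v c Tu Tv; rewrite le_eqVlt => /predU1P[->|uv fc].
  by rewrite !subrr mulr0.
have Bc : - B <= c by rewrite (le_trans (lowerB Tu))// fc// lexx.
have key p q : p <= q -> - B * (q - p) <= c * (q - p).
  by move=> pq; rewrite ler_wpM2r// subr_ge0.
have [va|av] := leP v a.
  have ua : u <= a by rewrite (le_trans (ltW uv)).
  rewrite !max_l ?ge_min ?va ?ua//; have := key _ _ (ltW uv); lra.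
have [bu|ub] := leP b u.
  rewrite (min_r (le_trans bu (ltW uv))).
  by have := key _ _ (ltW uv); lra.
have mc p q : TS p -> u <= p < v -> a <= p < b -> p <= q ->
    m * (q - p) <= c * (q - p).
  move=> Tp puv pab pq; rewrite ler_wpM2r ?subr_ge0//.
  by rewrite (le_trans (mf p Tp pab))// fc.
have [ua|au] := leP u a; have [vb|bv] := leP v b.
- rewrite (max_r (ltW av)).
  have := key _ _ ua; have := mc a v Ta; rewrite ua av lexx (lt_le_trans av vb).
  by move=> /(_ isT isT (ltW av)); lra.
- rewrite (max_r ab).
  move: ab; rewrite le_eqVlt => /predU1P[<-|ab'].
    by have := key _ _ (ltW uv); lra.
  have := key _ _ ua; have := key _ _ (ltW bv); have := mc a b Ta.
  by rewrite ua av lexx ab' => /(_ isT isT (ltW ab')); lra.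
- rewrite (max_r (ltW av)); have := mc u v Tu.
  by rewrite lexx uv (ltW au) ub => /(_ isT isT (ltW uv)); lra.
- rewrite (max_r ab); have := mc u b Tu; have := key _ _ (ltW bv).
  by rewrite lexx uv (ltW au) ub => + /(_ isT isT (ltW ub)); lra.
Qed.

Lemma upper_int_has_sup a b : TS a -> TS b -> a <= b ->
  has_sup [set G b - G a | G in subprimitive].
Proof.
move=> Ta Tb ab; split.
  have [|G subG _] := subprimitive_slope (m := - B) Ta ab.
    by move=> s Ts _; exact: lowerB.
  by exists (G b - G a), G.
exists (B * (b - a)) => _ [G subG <-]; apply: subG => // s Ts _; exact: upperB.
Qed.

Lemma upper_int_le a b c : TS a -> TS b -> a <= b ->
  (forall s, TS s -> a <= s < b -> f s <= c) -> upper_int a b <= c * (b - a).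
Proof.
move=> Ta Tb ab fc; apply: ge_sup; first exact: (upper_int_has_sup Ta Tb ab).1.
by move=> _ [G subG <-]; exact: subG.
Qed.

Lemma upper_int_ge a b m : TS a -> TS b -> a <= b ->
  (forall s, TS s -> a <= s < b -> m <= f s) -> m * (b - a) <= upper_int a b.
Proof.
move=> Ta Tb ab mf; have [G subG <-] := subprimitive_slope Ta ab mf.
apply: ub_le_sup; first exact: (upper_int_has_sup Ta Tb ab).2.
by exists G.
Qed.

(** Two subprimitives may be glued at a point of the time scale, hence the
    supremum may be attained on the two halves of an interval separately. *)
Lemma upper_int_add a b c : TS a -> TS b -> TS c -> a <= b -> b <= c ->
  upper_int a c = upper_int a b + upper_int b c.
Proof.
move=> Ta Tb Tc ab bc; have ac := le_trans ab bc.
have sab := upper_int_has_sup Ta Tb ab; have sbc := upper_int_has_sup Tb Tc bc.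
have sac := upper_int_has_sup Ta Tc ac.
apply/eqP; rewrite eq_le; apply/andP; split.
  apply: ge_sup; first exact: sac.1.
  move=> _ [G subG <-]; rewrite -(subrKA (G b)) addrC lerD//.
    by apply: ub_le_sup; [exact: sab.2|exists G].
  by apply: ub_le_sup; [exact: sbc.2|exists G].
rewrite -lerBrDr; apply: ge_sup; first exact: sab.1.
move=> _ [G subG <-]; rewrite lerBrDl -lerBrDr; apply: ge_sup; first exact: sbc.1.
move=> _ [H subH <-]; rewrite lerBrDr.
pose GH t := if t <= b then G t - G b else H t - H b.
apply: ub_le_sup; first exact: sac.2.
exists GH; last first.
  rewrite /GH ab; case: ifP => cb; last by ring.
  have -> : c = b by apply: le_anti; rewrite cb bc.
  ring.
move=> u v d Tu Tv uv fd; rewrite /GH.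
have [vb|bv] := leP v b.
  rewrite (le_trans uv vb) opprB addrA subrK; exact: subG.
have [ub|bu] := leP u b; last by rewrite opprB addrA subrK; exact: subH.
have := subG u b d Tu Tb ub; have := subH b v d Tb Tv (ltW bv).
move=> /(_ _)/wrap[s Ts /andP[bs sv]|Hd].
  by apply: fd; rewrite // (le_trans ub bs).
move=> /(_ _)/wrap[s Ts /andP[us sb]|Gd].
  by apply: fd; rewrite // us (lt_trans sb).
by rewrite (_ : d * (v - u) = d * (v - b) + d * (b - u)); [lra|ring].
Qed.

Lemma upper_int_bound a b c e : TS a -> TS b -> a <= b ->
  (forall s, TS s -> a <= s < b -> `|f s - c| <= e) ->
  `|upper_int a b - c * (b - a)| <= e * (b - a).
Proof.
move=> Ta Tb ab fce; have := @upper_int_le a b (c + e) Ta Tb ab.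
have := @upper_int_ge a b (c - e) Ta Tb ab.
move=> /(_ _)/wrap[s Ts sab|+ /(_ _)/wrap[s Ts sab|]].
- by have := fce s Ts sab; rewrite ler_norml; lra.
- by have := fce s Ts sab; rewrite ler_norml; lra.
by rewrite ler_norml; lra.
Qed.

(** The additive and monotone function [upper_int] is an antiderivative of f
    wherever f is continuous; at a right-scattered point nothing is asked of f
    besides boundedness, for [t, sigma(t)) contains no other point than t. *)
Lemma ex_real_antideriv : closed TS -> ~ has_ubound TS -> TS !=set0 ->
  (forall t, TS t -> right_dense TS t -> f s @[s --> within TS (nbhs t)] --> f t) ->
  exists F, is_antideriv TS f F.
Proof.
move=> cTS uTS [t0 Tt0] cf.
pose F t := if t0 <= t then upper_int t0 t else - upper_int t t0.
have FB a b : TS a -> TS b -> a <= b -> F b - F a = upper_int a b.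
  move=> Ta Tb ab; rewrite /F; have [ta|at0] := leP t0 a.
    by rewrite (le_trans ta ab) (upper_int_add Tt0 Ta Tb ta ab) addrC addKr.
  have [tb|bt] := leP t0 b.
    by rewrite (upper_int_add Ta Tt0 Tb (ltW at0) tb) opprK addrC.
  by rewrite (upper_int_add Ta Tb Tt0 ab (ltW bt)) opprK addrC addrK.
exists F => t [Tt _]; apply/is_delta_derivP; split=> //.
- exact: ts_kappa_unbounded.
- exact: fjump_in.
move=> e e0; have := fjump_ge uTS t; rewrite le_eqVlt => /predU1P[tj|tj].
  rewrite -tj; have /within_cvgP/(_ e e0)[r r0 fr] : f s @[s --> within TS (nbhs t)] --> f t.
    by apply: cf => //; split => //; have [s] := ts_exists_gt uTS t; exists s.
  exists r => // s Ts; have [st|ts] := leP s t => tsr.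
    rewrite (FB _ _ Ts Tt st) [_ *: _]mulrC [X in _ <= _ * X]ger0_norm ?subr_ge0//.
    apply: upper_int_bound => // v Tv /andP[sv vt].
    rewrite distrC; apply: fr => //; apply: le_lt_trans tsr.
    by rewrite !ger0_norm ?subr_ge0 ?(ltW vt)//; lra.
  rewrite -[F t - F s]opprB (FB _ _ Tt Ts (ltW ts)) -[t - s]opprB scaleNr -opprD !normrN.
  rewrite [_ *: _]mulrC [X in _ <= _ * X]gtr0_norm ?subr_gt0//.
  apply: upper_int_bound => // [|v Tv /andP[tv vs]]; first exact: ltW.
  rewrite distrC; apply: fr => //; apply: le_lt_trans tsr.
  by rewrite distrC [X in _ <= X]distrC !ger0_norm ?subr_ge0 ?(ltW ts)//; lra.
set j := fjump TS t in tj *; have Tj : TS j by exact: fjump_in.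
have Fj : F j - F t = f t * (j - t).
  rewrite (FB _ _ Tt Tj (ltW tj)); apply/eqP; rewrite -subr_eq0 -normr_le0.
  rewrite -[leRHS](mul0r (j - t)) upper_int_bound ?(ltW tj)// => s Ts /andP[ts sj].
  have [ts'|st|->] := ltgtP t s; last by rewrite subrr normr0.
    by have := fjump_le uTS Ts ts'; rewrite leNgt sj.
  by rewrite ltNge ts in st.
have B0 : 0 <= B by rewrite (le_trans _ (f_bounded Tt)).
(* The increment of F over [s, t] differs from f t * (t - s) by at most
   2 B (t - s), which is to be small against the gap j - t. *)
exists (Num.min (j - t) (e * (j - t) / (2 * B + 1))).
  by rewrite lt_min subr_gt0 tj divr_gt0 ?mulr_gt0 ?subr_gt0//; lra.
move=> s Ts; rewrite lt_min => /andP[sj st].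
have {}st' : s <= t.
  rewrite leNgt; apply/negP => ts; have := fjump_le uTS Ts ts; rewrite -/j.
  by move: sj; rewrite ltr_norml; lra.
have js : 0 <= j - s by rewrite subr_ge0 (le_trans st' (ltW tj)).
rewrite [X in _ <= _ * X]ger0_norm//.
rewrite -[F j - F s](subrKA (F t)) Fj (FB _ _ Ts Tt st') [_ *: _]mulrC.
rewrite (_ : _ + _ - _ = upper_int s t - f t * (t - s)); last by ring.
apply: (@le_trans _ _ (2 * B * (t - s))).
  apply: upper_int_bound => // v Tv _; rewrite (le_trans (ler_normB _ _))//.
  by have := f_bounded Tt; have := f_bounded Tv; lra.
move: st; rewrite ltr_pdivlMr; last by lra.
rewrite ger0_norm ?subr_ge0// => st; nra.
Qed.

End UpperIntegral.

Section RowVectors.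
Context {R : realType} {n : nat}.
Implicit Types (TS A : set R) (u v : 'rV[R]_n) (f F : R -> 'rV[R]_n).

Lemma row_norm_leP v (c : R) : 0 <= c ->
  `|v| <= c <-> forall j, `|v ord0 j| <= c.
Proof.
move=> c0; rewrite [`|v|]mx_normrE; split => [vc j|vc].
  by apply: le_trans vc; apply: (le_bigmax _ (fun ij => `|v ij.1 ij.2|) (ord0, j)).
by apply: bigmax_le => // -[i j] _; rewrite ord1; exact: vc.
Qed.

Lemma coord_le_norm v j : `|v ord0 j| <= `|v|.
Proof. exact: (row_norm_leP v (normr_ge0 v)).1. Qed.

Lemma is_delta_deriv_coord TS A F t (d : 'rV[R]_n) : is_delta_deriv TS A F t d <->
  [/\ ts_kappa TS t, A t, A (fjump TS t) &
   forall j, is_delta_deriv TS A (fun s => F s ord0 j) t (d ord0 j)].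
Proof.
split=> [[kt At Aj Fd]|[kt At Aj Fd]]; split=> //.
  move=> j; split => // e /Fd; apply: filterS => s /[apply]; apply: le_trans.
  by apply: le_trans (coord_le_norm _ j); rewrite !mxE.
move=> e e0.
pose close j s := A s ->
  `|F (fjump TS t) ord0 j - F s ord0 j - (fjump TS t - s) *: d ord0 j| <=
  e * `|fjump TS t - s|.
have Fclose j : \forall s \near t, close j s by have [_ _ _ /(_ e e0)] := Fd j.
have := filter_forall (nbhs_filter t) Fclose.
apply: filterS => s Fs As; apply/row_norm_leP; first by rewrite mulr_ge0// ltW.
by move=> j; have := Fs j As; rewrite !mxE.
Qed.

Lemma ex_antideriv TS f (B : R) : closed TS -> ~ has_ubound TS -> TS !=set0 ->
  (forall t, TS t -> `|f t| <= B) -> rd_continuous TS f ->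
  exists F, is_antideriv TS f F.
Proof.
move=> cTS uTS nTS fB [cf _].
have /choice[F FP] : forall j, exists G : R -> R,
    is_antideriv TS (fun t => f t ord0 j) G.
  move=> j; apply: (@ex_real_antideriv _ TS (fun t => f t ord0 j) B) => //.
    by move=> t Tt; exact: le_trans (coord_le_norm _ _) (fB t Tt).
  move=> t Tt rt; apply/within_cvgP => e /((within_cvgP _ _ _ _).1 (cf t Tt rt))[r r0 fr].
  exists r => // s Ts ts; apply: le_trans (fr s Ts ts).
  by apply: le_trans (coord_le_norm _ j); rewrite !mxE.
exists (fun t => \row_j F j t) => t kt; apply/is_delta_deriv_coord; split=> //.
- by case: kt.
- exact: fjump_in.
by move=> j; under eq_fun do rewrite mxE; exact: FP.
Qed.

End RowVectors.

Section Antiderivatives.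
Context {R : realType} {V : normedModType R} (TS : set R).
Hypothesis closedTS : closed TS.
Hypothesis unboundedTS : ~ has_ubound TS.
Implicit Types (a b c t : R) (f F : R -> V).

Lemma is_antideriv_mvt f F a b c : is_antideriv TS f F ->
  TS a -> TS b -> a <= b ->
  (forall t, TS t -> a <= t < b -> `|f t| <= c) -> `|F b - F a| <= c * (b - a).
Proof.
move=> Ff Ta Tb ab fc.
have dF t : TS t -> is_delta_deriv TS TS F t (f t).
  by move=> Tt; apply/Ff/ts_kappa_unbounded.
apply: (@delta_mvt _ _ TS _ _ _ F f) => //.
  apply: (@continuous_subspaceW _ _ _ TS) => [t []//|].
  by apply/within_continuousP => t /dF; exact: delta_deriv_continuous.
move=> t Jt tb; split; last by apply: fc; [exact: Jt.1|rewrite tb (andP Jt.2).1].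
apply: is_delta_deriv_sub (dF t Jt.1) => // [s []//|].
have Jb : ts_itv TS a b b by split; rewrite ?lexx ?ab.
exact: (fjump_itv closedTS unboundedTS Jt Jb tb).
Qed.

End Antiderivatives.

(** * The shift by the period *)

Section ShiftedTimeScale.
Context {R : realType} (TS Ts : set R) (t0 : R) (dp dm : R -> R -> R).
Context (Dp Dm : R -> R -> Prop) (T : R).
Hypothesis closedTS : closed TS.
Hypothesis unboundedTS : ~ has_ubound TS.
Hypothesis shifts : shift_operators TS Ts t0 dp dm Dp Dm.
Hypothesis t0T : t0 < T.
Hypothesis shift_dom : forall t, Ts t -> Dp T t /\ Dm T t.
Implicit Types (s t u : R).

(** On [t0, oo) the sets T* and T agree, because the shift of t0 by t is t. *)
Lemma shift_mem t : TS t -> t0 <= t -> Ts t.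
Proof.
move=> Tt t0t; have [Dt dpt] := shift_P3r shifts Tt t0t.
by have [_ _ _] := shift_domp shifts Dt; rewrite dpt.
Qed.

Lemma shift_in t : Ts t -> Ts (dp T t).
Proof. by move=> /shift_dom[/(shift_domp shifts)[]]. Qed.

Lemma unshift_in t : Ts t -> Ts (dm T t).
Proof. by move=> /shift_dom[_ /(shift_domm shifts)[]]. Qed.

Lemma shift_gt t : Ts t -> t < dp T t.
Proof.
move=> Tst; have [D0 {1}<-] := shift_P3l shifts Tst.
by apply: (shift_P2p shifts) => //; have [] := shift_dom Tst.
Qed.

Lemma shift_lt s t : Ts s -> Ts t -> s < t -> dp T s < dp T t.
Proof. by move=> /shift_dom[? _] /shift_dom[? _]; exact: (shift_P1p shifts). Qed.

Lemma shift_le s t : Ts s -> Ts t -> s <= t -> dp T s <= dp T t.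
Proof.
by move=> Ts' Tt; rewrite le_eqVlt => /predU1P[->//|/(shift_lt Ts' Tt)/ltW].
Qed.

Lemma unshift_lt s t : Ts s -> Ts t -> s < t -> dm T s < dm T t.
Proof. by move=> /shift_dom[_ ?] /shift_dom[_ ?]; exact: (shift_P1m shifts). Qed.

Lemma shiftK t : Ts t -> dm T (dp T t) = t.
Proof. by move=> /shift_dom[/(shift_P4p shifts)[]]. Qed.

Lemma unshiftK t : Ts t -> dp T (dm T t) = t.
Proof. by move=> /shift_dom[_ /(shift_P4m shifts)[]]. Qed.

(** The shift by T is an order isomorphism of T*, so it maps gaps to gaps. *)
Lemma shift_fjump t : TS t -> t0 <= t ->
  fjump TS (dp T t) = dp T (fjump TS t).
Proof.
move=> Tt t0t; have Tst := shift_mem Tt t0t.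
have t0d : t0 <= dp T t := le_trans t0t (ltW (shift_gt Tst)).
have tj := fjump_ge unboundedTS t.
have Tsj : Ts (fjump TS t) := shift_mem (fjump_in closedTS unboundedTS t) (le_trans t0t tj).
have Tsv : Ts (fjump TS (dp T t)).
  by apply: shift_mem; [exact: fjump_in|exact: le_trans (fjump_ge _ _)].
apply: le_anti; apply/andP; split.
  rewrite -[leLHS](unshiftK Tsv); apply: shift_le => //; first exact: unshift_in.
  apply: le_fjump => // s TSs ts; have Tss := shift_mem TSs (le_trans t0t (ltW ts)).
  rewrite leNgt; apply/negP => sv.
  have := shift_lt Tss (unshift_in Tsv) sv; rewrite unshiftK// ltNge fjump_le//.
    by have /(shift_domp shifts)[_ _ _ /(shift_subset shifts)] := (shift_dom Tss).1.
  exact: shift_lt.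
apply: le_fjump => // u Tu tu; have Tsu := shift_mem Tu (le_trans t0d (ltW tu)).
rewrite -[leRHS](unshiftK Tsu); apply: shift_le => //; first exact: unshift_in.
apply: fjump_le => //; first exact: (shift_subset shifts (unshift_in Tsu)).
by rewrite -[ltLHS](shiftK Tst); apply: unshift_lt => //; exact: shift_in.
Qed.

Let tau := shift_iter dp T t0.

Lemma shift_iter_in i : Ts (tau i).
Proof. by elim: i => [|i]; [exact: shift_origin shifts|exact: shift_in]. Qed.

Lemma shift_iter_ts i : TS (tau i).
Proof. exact: (shift_subset shifts (shift_iter_in i)). Qed.

Lemma shift_iter_lt i : tau i < tau i.+1.
Proof. exact: shift_gt (shift_iter_in i). Qed.

Lemma shift_iter_ge i : t0 <= tau i.
Proof. by elim: i => [|i /le_trans]; [exact: lexx|apply; exact/ltW/shift_iter_lt]. Qed.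

(** Were the iterates bounded, their supremum would lie in T* and be the shift
    of some smaller point, which no iterate could exceed. *)
Lemma shift_iter_unbounded t : exists i, t < tau i.
Proof.
apply: contrapT => nex; pose S := range tau.
have hS : has_sup S.
  split; first by exists t0, 0%N.
  by exists t => _ [i _ <-]; rewrite leNgt; apply/negP => ti; apply: nex; exists i.
have Sle i : tau i <= sup S by apply: ub_le_sup; [exact: hS.2|exists i].
have TSS : TS (sup S).
  by apply: closed_bounded_sup => // _ [i _ <-]; exact: shift_iter_ts.
have TsS : Ts (sup S) := shift_mem TSS (Sle 0%N).
have lt_dm : dm T (sup S) < sup S.
  by rewrite -[ltRHS](unshiftK TsS) shift_gt//; exact: unshift_in.
have [|_ [i _ <-]] := @sup_adherent _ S (sup S - dm T (sup S)) _ hS.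
  by rewrite subr_gt0.
rewrite subKr => /(shift_lt (unshift_in TsS) (shift_iter_in i)).
by rewrite unshiftK// ltNge (Sle i.+1).
Qed.

Lemma shift_iter_bracket t : t0 <= t -> exists i, tau i <= t < tau i.+1.
Proof.
move=> t0t; have [i ti] := shift_iter_unbounded t.
have [[|m] tm mmin] := ex_minnP (ex_intro (fun i => t < tau i) i ti).
  by move: tm; rewrite ltNge t0t.
exists m; rewrite tm andbT leNgt; apply/negP => /mmin; by rewrite ltnn.
Qed.

Let half := [set t | TS t /\ t0 <= t].

Lemma half_fjump t : half t -> half (fjump TS t).
Proof.
by move=> [_ t0t]; split; [exact: fjump_in|exact: le_trans (fjump_ge _ _)].
Qed.

(** Chain rule for the shift, which commutes with the forward jump. *)
Lemma shift_chain_rule (f F : R -> R) (d : R) t : is_antideriv TS f F ->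
  half t -> is_delta_deriv TS Ts (dp T) t d ->
  is_delta_deriv TS half (fun s => F (dp T s)) t (f (dp T t) * d).
Proof.
move=> Ff ht dd; have [Tt t0t] := ht; have Tst := shift_mem Tt t0t.
have Tdt := shift_subset shifts (shift_in Tst).
have kdt := ts_kappa_unbounded unboundedTS Tdt.
have cd := delta_deriv_continuous dd.
have /is_delta_derivP[kt _ _ {}dd] := dd.
have /is_delta_derivP[_ _ _ dF] := Ff _ kdt.
apply/is_delta_derivP; split => //; first exact: half_fjump.
move=> e e0; rewrite shift_fjump// in dF; set j := fjump TS t in dF dd *.
set dt := dp T t in dF cd Tdt kdt *.
(* The error of F o dp is at most z |dp j - dp s| + |f dt| z |j - s|, where
   |dp j - dp s| <= (|d| + 1) |j - s| as soon as z <= 1. *)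
pose z := Num.min 1 (e / (`|d| + 1 + `|f dt|)).
have c0 : 0 < `|d| + 1 + `|f dt| by rewrite ltr_wpDr// ltr_wpDl.
have z0 : 0 < z by rewrite lt_min ltr01 divr_gt0.
have [r1 r10 dF1] := dF z z0; have [r2 r20 dd2] := dd z z0.
have r12 : 0 < r1 / 2 by lra.
have /within_cvgP/(_ _ r12)[r3 r30 cd3] := cd.
exists (Num.min r2 r3); first by rewrite lt_min r20.
move=> s [Ts_ t0s]; have Tss := shift_mem Ts_ t0s.
rewrite lt_min => /andP[/(dd2 s Tss) {}dd2 /(cd3 s Tss) {}cd3].
have Tds := shift_subset shifts (shift_in Tss).
have := dF1 (dp T s) Tds; have dsr : `|dt - dp T s| < r1 by lra.
move=> /(_ dsr) {}dF1.
have scaleE (x y : R) : x *: y = x * y by [].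
rewrite !scaleE in dF1 dd2 *.
have Ad : `|dp T j - dp T s| <= (`|d| + 1) * `|j - s|.
  rewrite -[X in `|X|](subrK ((j - s) * d)) (le_trans (ler_normD _ _))//.
  rewrite [leRHS]mulrDl addrC lerD//; first by rewrite normrM mulrC.
  by rewrite (le_trans dd2)// ler_wpM2r// ge_min lexx.
rewrite (_ : _ - _ = F (dp T j) - F (dp T s) - (dp T j - dp T s) * f dt
  + (dp T j - dp T s - (j - s) * d) * f dt); last by ring.
rewrite (le_trans (ler_normD _ _))// normrM.
apply: (@le_trans _ _ (z * (`|d| + 1 + `|f dt|) * `|j - s|)).
  rewrite [in leRHS]mulrDr [leRHS]mulrDl lerD//.
    by rewrite (le_trans dF1)// -mulrA ler_wpM2l// ltW.
  by rewrite mulrAC ler_wpM2r.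
by rewrite ler_wpM2r// -ler_pdivlMr// ge_min lexx orbT.
Qed.

(** Change of variables in integrated form: for an antiderivative F of a
    quasiperiodic f, the function F(delta_+(T, t)) - gamma F(t) has derivative
    zero. *)
Lemma shift_antideriv (f F d : R -> R) (gamma a b : R) : is_antideriv TS f F ->
  (forall t, Ts t -> is_delta_deriv TS Ts (dp T) t (d t) /\
                     f (dp T t) * d t = gamma * f t) ->
  TS a -> TS b -> t0 <= a -> a <= b ->
  F (dp T b) - F (dp T a) = gamma * (F b - F a).
Proof.
move=> Ff dd Ta Tb t0a ab; pose G t := F (dp T t) + (- gamma) *: F t.
have dG t : half t -> is_delta_deriv TS half G t 0.
  move=> ht; have [Tt t0t] := ht; have [dt ft] := dd t (shift_mem Tt t0t).
  have kt := ts_kappa_unbounded unboundedTS Tt.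
  have -> : 0 = f (dp T t) * d t + (- gamma) *: f t :> R.
    by rewrite ft /GRing.scale/= mulNr subrr.
  apply: is_delta_derivD; first exact: shift_chain_rule.
  apply: is_delta_derivZ; apply: is_delta_deriv_sub (Ff _ kt) => //.
    by move=> s [].
  exact: half_fjump.
have Jhalf : ts_itv TS a b `<=` half.
  by move=> t [Tt /andP[at_ _]]; split => //; exact: le_trans at_.
have : `|G b - G a| <= 0 * (b - a).
  apply: (@delta_mvt _ _ TS _ _ _ G (fun=> 0)) => //.
    apply: (continuous_subspaceW Jhalf).
    by apply/within_continuousP => t /dG; exact: delta_deriv_continuous.
  move=> t Jt tb; rewrite normr0; split => //.
  apply: is_delta_deriv_sub (dG t (Jhalf t Jt)) => //.
  have Jb : ts_itv TS a b b by split; rewrite ?lexx ?ab.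
  exact: (fjump_itv closedTS unboundedTS Jt Jb tb).
rewrite mul0r normr_le0 subr_eq0 /G /GRing.scale/= => /eqP.
by move=> ?; rewrite mulrBr; lra.
Qed.

End ShiftedTimeScale.

(** * The averaged field *)

Section AveragedField.
Context {R : realType} {n : nat} (TS Ts : set R) (t0 : R) (dp dm : R -> R -> R).
Context (Dp Dm : R -> R -> Prop) (T gamma M lambda : R).
Context (D : set 'rV[R]_n) (X : R -> 'rV[R]_n -> 'rV[R]_n).
Hypothesis closedTS : closed TS.
Hypothesis unboundedTS : ~ has_ubound TS.
Hypothesis shifts : shift_operators TS Ts t0 dp dm Dp Dm.
Hypothesis t0T : t0 < T.
Hypothesis shift_dom : forall t, Ts t -> Dp T t /\ Dm T t.
Hypothesis quasi : forall x, D x -> forall j : 'I_n,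
  geom_quasiperiodic TS Ts dp Dp Dm T gamma (fun t => X t x ord0 j).
Hypothesis rdX : forall x, D x -> rd_continuous TS (fun t => X t x).
Hypothesis boundX : forall t x, TS t -> D x -> `|X t x| <= M.
Hypothesis lipX : forall t x1 x2, TS t -> D x1 -> D x2 ->
  `|X t x1 - X t x2| <= lambda * `|x1 - x2|.

Let tau := shift_iter dp T t0.
Let avg := avg_field TS dp T t0 gamma X.

(** Quasiperiodicity in integrated form: the integral of X over the i-th step
    is gamma ^+ i times its integral over the first one, so the averaged field
    is the mean of X over each step and gamma disappears from all estimates. *)
Lemma avg_field_mean x : D x -> exists2 F,
  is_antideriv TS (fun t => X t x) F &
  forall i, F (tau i.+1) - F (tau i) = (tau i.+1 - tau i) *: avg i x.
Proof.
move=> Dx.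
have nTS : TS !=set0 by exists t0; exact: (shift_iter_ts shifts shift_dom 0).
have exF := ex_antideriv closedTS unboundedTS nTS (fun t Tt => boundX Tt Dx) (rdX Dx).
exists (get [set F : R -> 'rV[R]_n | is_antideriv TS (fun t => X t x) F]).
  exact: (getPex exF).
rewrite /avg /avg_field /delta_int; set F := get _.
have Ff : is_antideriv TS (fun t => X t x) F by exact: (getPex exF).
move=> i; rewrite scalerA mulrCA mulfV ?mulr1; last first.
  by rewrite gt_eqF// subr_gt0 (shift_iter_lt shifts t0T shift_dom).
have -> : dp T t0 = tau 1 by [].
elim: i => [|i IH]; first by rewrite expr0 scale1r.
rewrite exprS -scalerA -{}IH.
apply/rowP => j; rewrite !mxE; have [_ [d dP]] := quasi Dx j.
apply: (shift_antideriv (F := fun t => F t ord0 j) (a := tau i) (b := tau i.+1)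
  closedTS unboundedTS shifts t0T shift_dom _ dP).
- by move=> t kt; have /is_delta_deriv_coord[_ _ _] := Ff t kt; exact.
- exact: shift_iter_ts shifts shift_dom i.
- exact: shift_iter_ts shifts shift_dom i.+1.
- exact: shift_iter_ge shifts t0T shift_dom i.
exact/ltW/(shift_iter_lt shifts t0T shift_dom).
Qed.

Let tau_ts i : TS (tau i) := shift_iter_ts shifts shift_dom i.
Let tau_lt i : tau i < tau i.+1 := shift_iter_lt shifts t0T shift_dom i.

Lemma avg_field_bound i x : D x -> `|avg i x| <= M.
Proof.
move=> Dx; have [F Ff Ftau] := avg_field_mean Dx.
have := is_antideriv_mvt (c := M) closedTS unboundedTS Ff (tau_ts i)
  (tau_ts i.+1) (ltW (tau_lt i)).
rewrite Ftau normrZ gtr0_norm ?subr_gt0// mulrC ler_pM2r ?subr_gt0//.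
by apply => t Tt _; exact: boundX.
Qed.

Lemma avg_field_lipschitz i x y : D x -> D y ->
  `|avg i x - avg i y| <= lambda * `|x - y|.
Proof.
move=> Dx Dy; have [F Ff Ftau] := avg_field_mean Dx.
have [G Gg Gtau] := avg_field_mean Dy.
have FG : is_antideriv TS (fun t => X t x - X t y) (fun t => F t + -1 *: G t).
  move=> t kt; rewrite -[- X t y]scaleN1r; apply: is_delta_derivD; first exact: Ff.
  by apply: is_delta_derivZ; exact: Gg.
have := is_antideriv_mvt (c := lambda * `|x - y|) closedTS unboundedTS
  FG (tau_ts i) (tau_ts i.+1) (ltW (tau_lt i)).
rewrite !scaleN1r opprD addrACA Ftau -opprD Gtau -scalerBr normrZ.
rewrite gtr0_norm ?subr_gt0// [_ * `|avg i x - _|]mulrC ler_pM2r ?subr_gt0//.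
by apply => t Tt _; exact: lipX.
Qed.

End AveragedField.

(** * The averaging estimate *)

Section Solutions.
Context {R : realType} {V : normedModType R} (TS : set R).
Hypothesis closedTS : closed TS.
Hypothesis unboundedTS : ~ has_ubound TS.
Implicit Types (a b c s t : R) (D : set V) (f : R -> V -> V) (y : R -> V).

Lemma ts_itvS a b a' b' : a <= a' -> b' <= b -> ts_itv TS a' b' `<=` ts_itv TS a b.
Proof.
move=> aa' bb' t [Tt /andP[at_ tb]]; split => //.
by rewrite (le_trans aa' at_) (le_trans tb bb').
Qed.

Lemma is_solution_sub a b a' b' D f y : a <= a' -> b' <= b ->
  is_solution TS (ts_itv TS a b) D f y -> is_solution TS (ts_itv TS a' b') D f y.
Proof.
move=> aa' bb' [cy dy]; have JJ := ts_itvS aa' bb'; split.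
  exact: continuous_subspaceW cy.
move=> t Jt [s [Js ts]]; have [|Dy dyt] := dy t (JJ t Jt).
  by exists s; split => //; exact: JJ.
split => //; apply: is_delta_deriv_sub dyt => //.
exact: (fjump_itv closedTS unboundedTS Jt Js ts).
Qed.

Lemma solution_lipschitz a b s t c D f y :
  is_solution TS (ts_itv TS a b) D f y ->
  (forall u v, TS u -> D v -> `|f u v| <= c) ->
  ts_itv TS a b s -> ts_itv TS a b t -> s <= t -> `|y t - y s| <= c * (t - s).
Proof.
move=> soly fc [Ts /andP[as_ _]] [Tt /andP[_ tb]] st.
have [cy dy] := is_solution_sub as_ tb soly.
apply: (@delta_mvt _ _ TS _ _ _ y (fun u => f u (y u))) => //.
move=> u Ju ut; have [|Dy dyu] := dy u Ju.
  by exists t; split => //; split => //; rewrite st lexx.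
by split => //; apply: fc => //; exact: Ju.1.
Qed.

End Solutions.

Section AveragingEstimate.
Context {R : realType} {n : nat} (TS : set R).
Context (D : set 'rV[R]_n) (f : R -> 'rV[R]_n -> 'rV[R]_n) (M lambda K : R).
Hypothesis closedTS : closed TS.
Hypothesis unboundedTS : ~ has_ubound TS.
Hypothesis M0 : 0 < M.
Hypothesis lambda0 : 0 < lambda.
Hypothesis boundf : forall t x, TS t -> D x -> `|f t x| <= M.
Hypothesis lipf : forall t x1 x2, TS t -> D x1 -> D x2 ->
  `|f t x1 - f t x2| <= lambda * `|x1 - x2|.
Context (eps : R).
Hypothesis eps0 : 0 < eps.

Section OneStep.
Context (a b : R) (g : 'rV[R]_n -> 'rV[R]_n) (x xi : R -> 'rV[R]_n).
Hypothesis Ta : TS a.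
Hypothesis Tb : TS b.
Hypothesis ab : a <= b.
Hypothesis abK : b - a <= K.
Hypothesis boundg : forall v, D v -> `|g v| <= M.
Hypothesis lipg : forall u v, D u -> D v -> `|g u - g v| <= lambda * `|u - v|.
Hypothesis solx :
  is_solution TS (ts_itv TS a b) D (fun t y => eps *: f t y) x.
Hypothesis solxi :
  is_solution TS (ts_itv TS a b) D (fun _ y => eps *: g y) xi.

Let Ja : ts_itv TS a b a. Proof. by split; rewrite ?lexx. Qed.
Let Jb : ts_itv TS a b b. Proof. by split; rewrite ?lexx ?andbT. Qed.

Let drift_bound (h : R -> 'rV[R]_n -> 'rV[R]_n) y t :
  (forall u v, TS u -> D v -> `|h u v| <= M) ->
  is_solution TS (ts_itv TS a b) D (fun s v => eps *: h s v) y ->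
  ts_itv TS a b t -> `|y t - y a| <= eps * M * K.
Proof.
move=> hM soly Jt; have [Tt /andP[at_ tb]] := Jt.
apply: le_trans (solution_lipschitz closedTS unboundedTS (c := eps * M) soly _ Ja Jt at_) _.
  by move=> u v Tu Dv; rewrite normrZ gtr0_norm// ler_pM2l// hM.
rewrite ler_wpM2l ?mulr_ge0 ?(ltW eps0) ?(ltW M0)//.
by apply: le_trans abK; rewrite lerD2r.
Qed.

Lemma step_drift t : ts_itv TS a b t ->
  `|x t - xi t| <= `|x a - xi a| + 2 * eps * M * K.
Proof.
move=> Jt; have xt := drift_bound boundf solx Jt.
have xit := drift_bound (h := fun=> g) (fun _ _ _ => @boundg _) solxi Jt.
have -> : x t - xi t = (x a - xi a) + ((x t - x a) - (xi t - xi a)).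
  by apply/rowP => j; rewrite !mxE; ring.
rewrite (le_trans (ler_normD _ _))// lerD2l (le_trans (ler_normB _ _))//.
by rewrite (_ : 2 * eps * M * K = eps * M * K + eps * M * K); [exact: lerD|ring].
Qed.

(** Subtracting from x - xi the oscillation of the integral of f(., xi a) about
    its mean leaves a function whose derivative is of order eps times the
    error; over a full step this oscillation vanishes. *)
Lemma step_error F : D (xi a) -> is_antideriv TS (fun t => f t (xi a)) F ->
  F b - F a = (b - a) *: g (xi a) ->
  `|x b - xi b| <= `|x a - xi a| +
    eps * lambda * (`|x a - xi a| + 2 * eps * M * K) * (b - a).
Proof.
move=> Dxia Ff Fab; set e := `|x a - xi a|; set y := xi a in Dxia Ff Fab *.
pose w t := x t + -1 *: xi t + (- eps) *: (F t + -1 *: (t *: g y)).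
pose dw t := eps *: f t (x t) + -1 *: (eps *: g (xi t))
  + (- eps) *: (f t y + -1 *: g y).
have wba : w b - w a = x b - xi b - (x a - xi a).
  have -> : w b - w a = x b - xi b - (x a - xi a)
      - eps *: (F b - F a - (b - a) *: g y).
    by apply/rowP => j; rewrite !mxE; ring.
  by rewrite Fab subrr scaler0 subr0.
suff : `|w b - w a| <= eps * lambda * (e + 2 * eps * M * K) * (b - a).
  rewrite wba => H; rewrite -[x b - xi b](subrK (x a - xi a)).
  by rewrite (le_trans (ler_normD _ _))// addrC lerD2l.
have cF : {within ts_itv TS a b, continuous F}.
  apply: (@continuous_subspaceW _ _ _ TS) => [t []//|].
  apply/within_continuousP => t /(ts_kappa_unbounded unboundedTS)/Ff.
  exact: delta_deriv_continuous.
have cid : {within ts_itv TS a b, continuous (fun t => t *: g y)}.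
  apply: (@continuous_subspaceW _ _ _ TS) => [t []//|].
  apply/within_continuousP => t Tt; apply: delta_deriv_continuous.
  apply: (is_delta_deriv_linear (g y) (ts_kappa_unbounded unboundedTS Tt) Tt).
  exact: fjump_in.
have [cx dx] := solx; have [cxi dxi] := solxi.
apply: (@delta_mvt _ _ TS _ _ _ w dw) => //.
  apply/within_continuousP => t Jt; rewrite /w.
  have cv (h : R -> 'rV[R]_n) : {within ts_itv TS a b, continuous h} ->
    h s @[s --> within (ts_itv TS a b) (nbhs t)] --> h t.
    by move=> /within_continuousP; exact.
  apply: cvgD.
    apply: cvgD; first exact: cv.
    by apply: cvgZ; [exact: cvg_cst|exact: cv].
  apply: cvgZ; first exact: cvg_cst.
    apply: cvgD; first exact: cv.
  by apply: cvgZ; [exact: cvg_cst|exact: (cv (fun t => t *: g y))].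
move=> t Jt tb; have Ex : exists s, ts_itv TS a b s /\ t < s by exists b.
have Jj := fjump_itv closedTS unboundedTS Jt Jb tb.
have [Dx dxt] := dx t Jt Ex; have [Dxi dxit] := dxi t Jt Ex.
have kt := ts_kappa_unbounded unboundedTS Jt.1.
split.
  apply: is_delta_derivD.
    by apply: is_delta_derivD => //; apply: is_delta_derivZ.
  apply: is_delta_derivZ; apply: is_delta_derivD.
    by apply: is_delta_deriv_sub (Ff t kt) => // s [].
  by apply: is_delta_derivZ; apply: is_delta_deriv_linear.
have -> : dw t = eps *: ((f t (x t) - f t y) - (g (xi t) - g y)).
  by apply/rowP => j; rewrite !mxE; ring.
rewrite normrZ gtr0_norm// -mulrA ler_pM2l// (le_trans (ler_normB _ _))//.
have := lipf Jt.1 Dx Dxia; have := lipg Dxi Dxia.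
have : `|x t - y| <= eps * M * K + e.
  rewrite -[x t - y](subrKA (x a)) (le_trans (ler_normD _ _))// lerD2r.
  exact: drift_bound boundf solx Jt.
have := drift_bound (h := fun=> g) (fun _ _ _ => @boundg _) solxi Jt.
rewrite -/y => xit xt /le_trans gl /le_trans fl.
apply: (@le_trans _ _ (lambda * (eps * M * K + e) + lambda * (eps * M * K))).
  by apply: lerD; [apply: fl|apply: gl]; rewrite ler_pM2l.
by rewrite -mulrDr ler_pM2l//; lra.
Qed.

End OneStep.

End AveragingEstimate.

Section GlobalEstimate.
Context {R : realType} {n : nat} (TS Ts : set R) (t0 : R) (dp dm : R -> R -> R).
Context (Dp Dm : R -> R -> Prop) (T gamma M lambda K : R).
Context (D : set 'rV[R]_n) (X : R -> 'rV[R]_n -> 'rV[R]_n).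
Hypothesis closedTS : closed TS.
Hypothesis unboundedTS : ~ has_ubound TS.
Hypothesis shifts : shift_operators TS Ts t0 dp dm Dp Dm.
Hypothesis t0T : t0 < T.
Hypothesis shift_dom : forall t, Ts t -> Dp T t /\ Dm T t.
Hypothesis quasi : forall x, D x -> forall j : 'I_n,
  geom_quasiperiodic TS Ts dp Dp Dm T gamma (fun t => X t x ord0 j).
Hypothesis rdX : forall x, D x -> rd_continuous TS (fun t => X t x).
Hypothesis M0 : 0 < M.
Hypothesis lambda0 : 0 < lambda.
Hypothesis K0 : 0 < K.
Hypothesis boundX : forall t x, TS t -> D x -> `|X t x| <= M.
Hypothesis lipX : forall t x1 x2, TS t -> D x1 -> D x2 ->
  `|X t x1 - X t x2| <= lambda * `|x1 - x2|.

Let tau := shift_iter dp T t0.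
Hypothesis step_le : forall i, tau i.+1 - tau i <= K.

Context (eps : R) (xi : R -> 'rV[R]_n).
Hypothesis eps0 : 0 < eps.
Hypothesis xi_in : forall t, TS t -> t0 <= t -> D (xi t).
Hypothesis xi_sol : is_avg_solution TS dp T t0 gamma eps D X xi.

Let tau_ts i : TS (tau i) := shift_iter_ts shifts shift_dom i.
Let tau_lt i : tau i < tau i.+1 := shift_iter_lt shifts t0T shift_dom i.
Let tau_ge i : t0 <= tau i := shift_iter_ge shifts t0T shift_dom i.

Context (b : R) (x : R -> 'rV[R]_n).
Hypothesis x_xi : x t0 = xi t0.
Hypothesis x_sol :
  is_solution TS (ts_itv TS t0 b) D (fun t y => eps *: X t y) x.

Let avg_bound i v := avg_field_bound closedTS unboundedTS shifts t0T shift_dom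
  quasi rdX boundX i (x := v).
Let avg_lip i u v := avg_field_lipschitz closedTS unboundedTS shifts t0T
  shift_dom quasi rdX boundX lipX i (x := u) (y := v).

(** Discrete Gronwall inequality along the steps: the error increased by
    2 eps M K is multiplied by at most 1 + eps lambda h over a step of
    length h. *)
Lemma error_at_steps i : tau i <= b ->
  `|x (tau i) - xi (tau i)| + 2 * eps * M * K <=
  expR (lambda * eps * (tau i - t0)) * (2 * eps * M * K).
Proof.
elim: i => [|i IH] tib.
  by rewrite /tau /= x_xi !subrr normr0 mulr0 expR0 mul1r add0r.
have tib' : tau i <= b := le_trans (ltW (tau_lt i)) tib.
have [F Ff Fmean] := avg_field_mean closedTS unboundedTS shifts t0T shift_dom
  quasi rdX boundX (xi_in (tau_ts i) (tau_ge i)).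
have solx := is_solution_sub closedTS unboundedTS (tau_ge i) tib x_sol.
have /= := step_error closedTS unboundedTS M0 lambda0 boundX lipX eps0
  (tau_ts i) (tau_ts i.+1) (ltW (tau_lt i)) (step_le i) (@avg_bound i)
  (@avg_lip i) solx (xi_sol i) (xi_in (tau_ts i) (tau_ge i)) Ff (Fmean i).
set e := `|x (tau i) - xi (tau i)| in IH *; set h := tau i.+1 - tau i.
move=> err.
apply: (@le_trans _ _ ((1 + lambda * eps * h) * (e + 2 * eps * M * K))).
  apply: (@le_trans _ _ (e + eps * lambda * (e + 2 * eps * M * K) * h + 2 * eps * M * K)).
    by rewrite lerD2r.
  by rewrite le_eqVlt; apply/orP; left; apply/eqP; ring.
have h0 : 0 <= h by rewrite subr_ge0 ltW.
have [? ? ? ?] : [/\ 0 <= eps, 0 <= lambda, 0 <= M & 0 <= K] by split; exact: ltW.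
have -> : lambda * eps * (tau i.+1 - t0) =
  lambda * eps * h + lambda * eps * (tau i - t0) by rewrite /h; ring.
rewrite expRD -[leRHS]mulrA; apply: ler_pM => //.
- by rewrite addr_ge0// !mulr_ge0.
- by rewrite addr_ge0 ?normr_ge0// !mulr_ge0.
- exact: expR_ge1Dx.
exact: IH.
Qed.

Lemma averaging_estimate (L : R) t : b <= t0 + L * eps^-1 ->
  ts_itv TS t0 b t -> `|x t - xi t| <= 2 * M * K * expR (lambda * L) * eps.
Proof.
move=> bL Jt; have [Tt /andP[t0t tb]] := Jt.
have [i /andP[it ti]] := shift_iter_bracket closedTS shifts t0T shift_dom t0t.
have solx := is_solution_sub closedTS unboundedTS (tau_ge i) tb x_sol.
have solxi := is_solution_sub closedTS unboundedTS (lexx _) (ltW ti) (xi_sol i).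
have tK : t - tau i <= K.
  by apply: le_trans (step_le i); rewrite lerD2r; exact: ltW.
have Jt' : ts_itv TS (tau i) t t by split; rewrite // lexx andbT.
apply: le_trans (step_drift closedTS unboundedTS M0 boundX eps0
  (tau_ts i) it tK (@avg_bound i) solx solxi Jt') _.
apply: le_trans (error_at_steps (le_trans it tb)) _.
rewrite [leRHS](_ : _ = expR (lambda * L) * (2 * eps * M * K)); last by ring.
have [? ? ?] : [/\ 0 <= eps, 0 <= M & 0 <= K] by split; exact: ltW.
rewrite ler_wpM2r ?mulr_ge0//.
rewrite ler_expR -mulrA ler_pM2l// mulrC -ler_pdivlMr//.
by have := le_trans it (le_trans tb bL); rewrite -/(shift_iter dp T t0 i) -/tau; lra.
Qed.

End GlobalEstimate.

(** * Existence of the solution on a prescribed interval *)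

Section LeftLimit.
Context {R : realType} {n : nat}.

Lemma lipschitz_left_limit (S : set R) (b c : R) (y : R -> 'rV[R]_n) :
  0 <= c -> closure S b -> (forall s, S s -> s < b) ->
  (forall s t, S s -> S t -> s <= t -> `|y t - y s| <= c * (t - s)) ->
  exists l, forall s, S s -> `|l - y s| <= c * (b - s).
Proof.
move=> c0 clb Sb ylip.
have PF : ProperFilter (within S (nbhs b)) by exact: within_nbhs_proper.
have c1 : 0 < c + 1 by lra.
have small (e : R) : 0 < e -> \forall s \near within S (nbhs b), S s /\ b - s < e.
  move=> e0; rewrite near_withinE; apply/nbhs_ballP; exists e => // s.
  rewrite -ball_normE /= => bs Ss; split => //.
  by rewrite -(ger0_norm (_ : 0 <= b - s)) // subr_ge0 ltW// Sb.
have : cvg (y @ within S (nbhs b)).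
  apply/cauchy_cvgP; apply: cauchy_exP => e e0.
  have e1 : 0 < e / (c + 1) by rewrite divr_gt0.
  have [s [Ss bs]] := @filter_ex _ _ PF _ (small _ e1).
  exists (y s); apply: filterS (small _ e1) => t [St bt].
  rewrite -ball_normE /=; move: bs bt; rewrite !ltr_pdivlMr// => bs bt.
  have := Sb _ Ss; have := Sb _ St.
  have [st|/ltW ts] := leP s t.
    have := ylip s t Ss St st; rewrite distrC; nra.
  have := ylip t s St Ss ts; nra.
move=> /cvg_ex[l /cvgrPdist_lt yl]; exists l => s Ss.
apply/ler_addgt0Pr => e e0.
have bs : 0 < b - s by rewrite subr_gt0 Sb.
have [t [/= ylt [St bt]]] := @filter_ex _ _ PF _ (filterI (yl e e0) (small _ bs)).
have st : s <= t by lra.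
rewrite -(subrKA (y t)) (le_trans (ler_normD _ _))//.
have := ylip s t Ss St st; have := Sb _ St; nra.
Qed.

End LeftLimit.


Section Existence.
Context {R : realType} {n : nat} (TS : set R).
Context (D : set 'rV[R]_n) (f : R -> 'rV[R]_n -> 'rV[R]_n) (c lambda : R).
Hypothesis closedTS : closed TS.
Hypothesis unboundedTS : ~ has_ubound TS.
Hypothesis c0 : 0 < c.
Hypothesis lambda0 : 0 < lambda.
Hypothesis rdf : forall x, D x -> rd_continuous TS (fun t => f t x).
Hypothesis boundf : forall t x, TS t -> D x -> `|f t x| <= c.
Hypothesis lipf : forall t x1 x2, TS t -> D x1 -> D x2 ->
  `|f t x1 - f t x2| <= lambda * `|x1 - x2|.
Implicit Types (y z : R -> 'rV[R]_n) (s t a b : R).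

Let sol a b y := is_solution TS (ts_itv TS a b) D f y.

(** The equation also holds to the left of the right end b of a solution: at a
    right-dense b because f is continuous there, at a right-scattered b because
    then it only compares s with the jump of b, at a positive distance. *)
Lemma solution_left_deriv a b y (e : R) : sol a b y -> TS b -> a <= b -> D (y b) ->
  0 < e -> exists2 r, 0 < r & forall s, ts_itv TS a b s -> `|b - s| < r ->
    `|y b - y s - (b - s) *: f b (y b)| <= e * (fjump TS b - s).
Proof.
move=> soly Tb ab Dyb e0; have bj := fjump_ge unboundedTS b.
suff [r r0 yr] : exists2 r, 0 < r & forall s, TS s -> a <= s -> s < b -> b - s < r ->
    `|y b - y s - (b - s) *: f b (y b)| <= e * (fjump TS b - s).
  exists r => // s [Ts /andP[as_]]; rewrite le_eqVlt => /predU1P[->|sb].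
    move=> _; rewrite !subrr scale0r subrr normr0; apply: mulr_ge0; first exact: ltW.
    by rewrite subr_ge0.
  by rewrite gtr0_norm ?subr_gt0//; exact: yr.
have [cy dy] := soly; move: bj; rewrite le_eqVlt => /predU1P[bj|bj].
  have rdb : right_dense TS b.
    by split => //; have [s] := ts_exists_gt unboundedTS b; exists s.
  have e2 : 0 < e / 2 by lra.
  have /within_cvgP/(_ _ e2)[r1 r10 fr] := (rdf Dyb).1 b Tb rdb.
  have lc : 0 < lambda * c by rewrite mulr_gt0.
  exists (Num.min r1 (e / 2 / (lambda * c))); first by rewrite lt_min r10 divr_gt0.
  move=> s Ts as_ sb; rewrite lt_min ltr_pdivlMr// => /andP[bsr bse].
  pose w t := y t + -1 *: (t *: f b (y b)).
  have -> : y b - y s - (b - s) *: f b (y b) = w b - w s.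
    by apply/rowP => j; rewrite !mxE; ring.
  have [cy' dy'] := is_solution_sub closedTS unboundedTS as_ (lexx b) soly.
  have Jb : ts_itv TS s b b by split; rewrite ?lexx ?andbT// ltW.
  rewrite -bj.
  apply: (@delta_mvt _ _ TS _ _ _ w (fun t => f t (y t) + -1 *: f b (y b))) => //.
  - exact: ltW.
  - apply/within_continuousP => t Jt; apply: cvgD.
      by move: t Jt; apply/within_continuousP.
    apply: cvgZ; first exact: cvg_cst.
    apply: cvgZr_tmp; exact: cvg_within.
  - move=> t Jt tb; have [Tt /andP[st _]] := Jt; have [|Dyt dyt] := dy' t Jt.
      by exists b.
    have Jj := fjump_itv closedTS unboundedTS Jt Jb tb.
    split.
      apply: is_delta_derivD => //; apply: is_delta_derivZ.
      by apply: is_delta_deriv_linear => //; exact: ts_kappa_unbounded.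
    have ylip := solution_lipschitz closedTS unboundedTS
      (is_solution_sub closedTS unboundedTS as_ (lexx b) soly) boundf Jt Jb (ltW tb).
    have ft : `|f t (y t) - f t (y b)| <= e / 2.
      apply: le_trans (lipf Tt Dyt Dyb) _; rewrite distrC.
      apply: (@le_trans _ _ (lambda * (c * (b - t)))); first by rewrite ler_pM2l.
      rewrite mulrA; apply: le_trans (ltW bse); rewrite mulrC ler_pM2r//.
      by rewrite lerD2l lerN2.
    have fb : `|f t (y b) - f b (y b)| <= e / 2.
      rewrite distrC; apply: fr => //; apply: le_lt_trans bsr.
      by rewrite gtr0_norm ?subr_gt0// lerD2l lerN2.
    rewrite scaleN1r -(subrKA (f t (y b))) (le_trans (ler_normD _ _))//.
    by rewrite [e]splitr lerD.
(* Here the whole left-hand side is at most (b - s) m, while fjump TS b - s is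
   at least the positive gap at b. *)
pose m := c + `|f b (y b)|; have m0 : 0 < m by rewrite ltr_wpDr.
exists (e * (fjump TS b - b) / m); first by rewrite divr_gt0 ?mulr_gt0 ?subr_gt0.
move=> s Ts as_ sb; rewrite ltr_pdivlMr// => bse.
have Js : ts_itv TS a b s by split; rewrite // as_ ltW.
have Jb : ts_itv TS a b b by split; rewrite ?lexx ?andbT.
have := solution_lipschitz closedTS unboundedTS soly boundf Js Jb (ltW sb).
move=> ys; rewrite (le_trans (ler_normB _ _))// normrZ gtr0_norm ?subr_gt0//.
apply: (@le_trans _ _ ((b - s) * m)); first by rewrite /m; lra.
apply: (le_trans (ltW bse)); rewrite ler_pM2l//; lra.
Qed.

Lemma solution_glue a b d y z : a <= b -> b < d -> TS b -> TS d -> y b = z b ->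
  sol a b y -> sol b d z -> sol a d (fun t => if t <= b then y t else z t).
Proof.
move=> ab bd Tb Td yzb soly solz; set w := fun t => _.
have [cy dy] := soly; have [cz dz] := solz.
have Jb : ts_itv TS b d b by split; rewrite ?lexx ?ltW.
have Jd : ts_itv TS b d d by split; rewrite ?lexx ?ltW.
have Jab : ts_itv TS a b b by split; rewrite ?lexx ?ab.
have wl t : t <= b -> w t = y t by move=> tb; rewrite /w tb.
have wr t : b <= t -> w t = z t.
  rewrite /w le_eqVlt => /predU1P[<-|bt]; first by rewrite lexx.
  by rewrite leNgt bt.
have [Dzb dzb] : D (z b) /\ is_delta_deriv TS (ts_itv TS b d) z b (f b (z b)).
  by apply: dz => //; exists d.
have Jad t : ts_itv TS a d t -> t <= b -> ts_itv TS a b t.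
  by move=> [Tt /andP[at_ _]] tb; split; rewrite ?at_.
have Jbd t : ts_itv TS a d t -> b <= t -> ts_itv TS b d t.
  by move=> [Tt /andP[_ td]] bt; split; rewrite ?bt.
have bj := fjump_ge unboundedTS b.
have Jj := fjump_itv closedTS unboundedTS Jb Jd bd.
have dwd t : ts_itv TS a d t -> t < d ->
    D (w t) /\ is_delta_deriv TS (ts_itv TS a d) w t (f t (w t)).
  move=> Jt td; have Jdd : ts_itv TS a d d.
    by split; rewrite ?lexx ?(le_trans ab (ltW bd)).
  have Jjt := fjump_itv closedTS unboundedTS Jt Jdd td.
  have [tb|bt|tb] := ltgtP t b.
  - have [|Dyt dyt] := dy t (Jad t Jt (ltW tb)); first by exists b.
    have tbr : 0 < b - t by rewrite subr_gt0.
    rewrite wl ?(ltW tb)//; split => //; apply: (is_delta_deriv_local tbr dyt) => //.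
      by rewrite wl//; exact: fjump_le.
    move=> s Js ts; have sb : s <= b by move: ts; rewrite ltr_norml; lra.
    by split; [exact: Jad|rewrite wl].
  - have [|Dzt dzt] := dz t (Jbd t Jt (ltW bt)); first by exists d.
    have tbr : 0 < t - b by rewrite subr_gt0.
    rewrite wr ?(ltW bt)//; split => //; apply: (is_delta_deriv_local tbr dzt) => //.
      by rewrite wr// (le_trans (ltW bt))// fjump_ge.
    move=> s Js ts; have sb : b <= s by move: ts; rewrite ltr_norml; lra.
    by split; [exact: Jbd|rewrite wr].
  subst t; rewrite wr//; split => //; apply/is_delta_derivP; split => //.
    exact: ts_kappa_unbounded.
  move=> e e0; have Dyb : D (y b) by rewrite yzb.
  have /is_delta_derivP[_ _ _ /(_ e e0)[r1 r10 zr]] := dzb.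
  have [r2 r20 yr] := solution_left_deriv soly Tb ab Dyb e0.
  exists (Num.min r1 r2); first by rewrite lt_min r10.
  move=> s Js; rewrite lt_min => /andP[sr1 sr2]; rewrite (wr _ bj).
  have [sb|/ltW bs] := leP s b; last by rewrite wr//; apply: zr => //; exact: Jbd.
  rewrite wl// [`|_ - s|]ger0_norm; last by rewrite subr_ge0 (le_trans sb).
  apply: le_trans (yr s (Jad s Js sb) sr2); rewrite yzb.
  have -> : z (fjump TS b) = z b + (fjump TS b - b) *: f b (z b).
    by rewrite -(delta_deriv_jump dzb) addrC subrK.
  rewrite le_eqVlt; apply/orP; left; apply/eqP; congr (`|_|).
  by apply/rowP => j; rewrite !mxE; ring.
split; last by move=> t Jt [s [[Ts /andP[_ sd]] ts]]; apply: dwd => //; exact: lt_le_trans sd.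
apply/within_continuousP => t Jt; have [_ /andP[_]] := Jt.
rewrite le_eqVlt => /predU1P[td|td]; last first.
  by have [_] := dwd t Jt td; exact: delta_deriv_continuous.
subst t; apply/within_cvgP => e e0.
have /within_continuousP/(_ d Jd)/within_cvgP/(_ e e0)[r r0 zr] := cz.
exists (Num.min r (d - b)); first by rewrite lt_min r0 subr_gt0.
move=> s Js; rewrite lt_min => /andP[sr sd].
have bs : b <= s by move: sd; rewrite ltr_norml; lra.
by rewrite !wr ?(ltW bd)//; apply: zr => //; exact: Jbd.
Qed.

Context (t0 : R) (x0 : 'rV[R]_n) (b1 : R).
Hypothesis Tt0 : TS t0.
Hypothesis Tb1 : TS b1.
Hypothesis t0b1 : t0 <= b1.
Hypothesis well_posed : cauchy_well_posed TS t0 D f.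
Hypothesis a_priori : forall b y, TS b -> t0 <= b -> b <= b1 -> y t0 = x0 ->
  sol t0 b y -> (interior D) (y b).

Let reach b y := y t0 = x0 /\ sol t0 b y.

Let reached := [set b | [/\ TS b, t0 <= b, b <= b1 & exists y, reach b y]].

Let reach0 : reach t0 (fun=> x0).
Proof.
split => //; split.
  by apply/within_continuousP => t _; exact: cvg_cst.
by move=> t [_ /andP[]] t0t _ [s [[_ /andP[_ st0]]]]; rewrite ltNge (le_trans st0).
Qed.

Let x0_in : (interior D) x0.
Proof. exact: (a_priori Tt0 (lexx _) t0b1 _ reach0.2). Qed.

Lemma reach_unique b b' y z t : TS b -> b <= b' -> reach b y -> reach b' z ->
  ts_itv TS t0 b t -> y t = z t.
Proof.
move=> Tb bb' [y0 soly] [z0 solz] Jt; have [_ /andP[t0t tb]] := Jt.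
have := le_trans t0t tb; rewrite le_eqVlt => /predU1P[t0b|t0b].
  have -> : t = t0 by apply: le_anti; rewrite t0t t0b tb.
  by rewrite y0 z0.
have [_ uniq] := well_posed Tt0 (lexx _) x0_in.
apply: (uniq b y z Tb t0b y0 z0 soly _ t Jt).
exact: is_solution_sub solz.
Qed.

(** The solutions on the intervals [t0, b], b < sup reached, agree and are
    Lipschitz, so their union extends continuously to the supremum. *)
Lemma reached_sup_closed : reached (sup reached).
Proof.
have hS : has_sup reached.
  split; first by exists t0; split => //; exists (fun=> x0); exact: reach0.
  by exists b1 => b [].
set B := sup reached; apply: contrapT => nB.
have leB b : reached b -> b <= B by move=> Sb; apply: ub_le_sup => //; exact: hS.2.
have ltB b : reached b -> b < B.
  by move=> Sb; have := leB b Sb; rewrite le_eqVlt => /predU1P[bB|//]; rewrite -bB in nB.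
have TB : TS B by apply: closed_bounded_sup => // b [].
have t0S : reached t0 by split => //; exists (fun=> x0); exact: reach0.
have Bb1 : B <= b1 by apply: ge_sup => [|b []//]; exact: hS.1.
have /choice[Y YP] b : exists y, reached b -> reach b y.
  have [[_ _ _ [y yP]]|nb] := pselect (reached b); first by exists y.
  by exists (fun=> x0).
have /choice[beta betaP] t : exists b, t < B -> reached b /\ t < b.
  have [tB|] := ltP t B; last by exists t0.
  have [|b Sb tb] := @sup_adherent _ reached (B - t) _ hS; first by rewrite subr_gt0.
  by exists b => _; split => //; move: tb; rewrite -/B subKr.
(* beta t is a point beyond t whose solution Y (beta t) defines y at t. *)
pose y t := Y (beta t) t.
have yE b t : reached b -> ts_itv TS t0 b t -> y t = Y b t.
  move=> Sb Jt; have [Tt /andP[t0t tb]] := Jt.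
  have [Sbt tbt] := betaP t (le_lt_trans tb (ltB b Sb)).
  have Jt' : ts_itv TS t0 (beta t) t by split; rewrite // t0t ltW.
  have [Tb _ _ _] := Sb; have [Tbt _ _ _] := Sbt.
  have [bb|/ltW bb] := leP b (beta t).
    by rewrite /y (reach_unique Tb bb (YP b Sb) (YP _ Sbt)).
  by rewrite /y (reach_unique Tbt bb (YP _ Sbt) (YP b Sb)).
pose S := [set t | [/\ TS t, t0 <= t & t < B]].
have SJ t : S t -> ts_itv TS t0 (beta t) t.
  by move=> [Tt t0t tB]; have [_ /ltW tb] := betaP t tB; split; rewrite ?t0t.
have [|||l yl] := @lipschitz_left_limit R n S B c y (ltW c0).
- move=> U /nbhs_ballP[r r0 rU].
  have [b Sb br] := @sup_adherent _ reached r r0 hS.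
  have bB := ltB b Sb; have [Tb t0b _ _] := Sb.
  exists b; split; first by split.
  by apply: rU; rewrite -ball_normE /= gtr0_norm ?subr_gt0//; move: br; rewrite -/B; lra.
- by move=> s [].
- move=> s t Ss St st; have [Sbt _] := betaP t (let: And3 _ _ tB := St in tB).
  have Jt := SJ t St; have Js : ts_itv TS t0 (beta t) s.
    have [_ /andP[_ tb]] := Jt; case: Ss => Ts t0s _.
    by split; rewrite // t0s (le_trans st).
  rewrite (yE _ _ Sbt Jt) (yE _ _ Sbt Js).
  exact: (solution_lipschitz closedTS unboundedTS (YP _ Sbt).2 boundf).
apply: nB; split => //; first exact: leB.
pose w t := if t < B then y t else l.
have wy t : t < B -> w t = y t by move=> tB; rewrite /w tB.
have wd t : ts_itv TS t0 B t -> t < B ->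
    D (w t) /\ is_delta_deriv TS (ts_itv TS t0 B) w t (f t (w t)).
  move=> [Tt /andP[t0t _]] tB; have [Sb tb] := betaP t tB.
  set b := beta t in Sb tb; have bB := ltB b Sb; have [Tb t0b _ _] := Sb.
  have Jt : ts_itv TS t0 b t by split; rewrite ?t0t ?ltW.
  have Jb : ts_itv TS t0 b b by split; rewrite ?t0b ?lexx.
  have wE s : ts_itv TS t0 b s -> w s = Y b s.
    move=> Js; rewrite wy; first exact: yE.
    by have [_ /andP[_ sb]] := Js; exact: le_lt_trans bB.
  have JB : ts_itv TS t0 b `<=` ts_itv TS t0 B.
    by apply: ts_itvS => //; exact: ltW.
  have [_ /(_ t Jt)[|DY dY]] := (YP b Sb).2; first by exists b.
  have Jj := fjump_itv closedTS unboundedTS Jt Jb tb.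
  have tbr : 0 < b - t by rewrite subr_gt0.
  rewrite (wE t Jt); split => //; apply: (is_delta_deriv_local tbr dY) => //.
  - exact: JB.
  - exact: JB.
  - exact: wE.
  move=> s [Ts /andP[t0s _]] ts.
  have Js : ts_itv TS t0 b s.
    by split; rewrite // t0s; move: ts; rewrite ltr_norml; lra.
  by split => //; exact: wE.
exists w; split.
  have [Sb tb] := betaP t0 (ltB t0 t0S).
  by rewrite wy ?ltB// /y; have [] := YP _ Sb.
split; last first.
  by move=> t Jt [s [[_ /andP[_ sB]] ts]]; apply: wd => //; exact: lt_le_trans sB.
apply/within_continuousP => t Jt; have [Tt /andP[t0t]] := Jt.
rewrite le_eqVlt => /predU1P[tB|tB]; last first.
  by have [_] := wd t Jt tB; exact: delta_deriv_continuous.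
subst t; apply/within_cvgP => e e0; have c1 : 0 < c + 1 by rewrite addr_gt0.
exists (e / (c + 1)); first by rewrite divr_gt0.
move=> s [Ts /andP[t0s sB]] Bs; rewrite {1}/w ltxx.
move: sB; rewrite le_eqVlt => /predU1P[->|sB].
  by rewrite /w ltxx subrr normr0 ltW.
rewrite wy//; apply: le_trans (yl s _) _; first by split.
by move: Bs; rewrite ltr_pdivlMr// gtr0_norm ?subr_gt0//; nra.
Qed.

(** Continuation: a solution that stays in the interior of D can be extended
    beyond any point before b1 by local well-posedness, so the supremum of the
    points reached by solutions is b1. *)
Lemma ex_solution : exists y, y t0 = x0 /\ sol t0 b1 y.
Proof.
have [TB t0B] := reached_sup_closed; set B := sup reached in TB t0B *.
rewrite le_eqVlt => /predU1P[<-//|Bb1] [y [y0 soly]].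
have yB := a_priori TB t0B (ltW Bb1) y0 soly.
have [[b [z [Tb Bb zB solz]]] _] := well_posed TB t0B yB.
pose d := Num.min b b1.
have Td : TS d by rewrite /d; case: leP.
have Bd : B < d by rewrite lt_min Bb.
suff /ub_le_sup : reached d.
  move=> /(_ (ex_intro _ b1 _))/wrap[s []//|]; by rewrite -/B leNgt Bd.
split => //; [exact: le_trans (ltW Bd)|by rewrite ge_min lexx orbT|].
exists (fun t => if t <= B then y t else z t); split; first by rewrite t0B.
apply: solution_glue => //.
by apply: is_solution_sub solz => //; rewrite ge_min lexx.
Qed.

End Existence.

(** * The theorem *)

Lemma rd_continuousZ (R : realType) (V : normedModType R) (TS : set R)
    (f : R -> V) (k : R) :
  rd_continuous TS f -> rd_continuous TS (fun t => k *: f t).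
Proof.
move=> [cf lf]; split=> t Tt; first by move=> /(cf t Tt); exact: cvgZl_tmp.
by move=> /(lf t Tt)[l fl]; exists (k *: l); exact: cvgZl_tmp.
Qed.

Lemma ts_itv_last (R : realType) (TS : set R) (a b : R) : closed TS -> TS a ->
  a <= b -> exists c, [/\ TS c, a <= c, c <= b & ts_itv TS a b = ts_itv TS a c].
Proof.
move=> cTS Ta ab; pose S := [set t | TS t /\ t <= b].
have hS : has_sup S by split; [exists a | exists b => t []].
have leS t : S t -> t <= sup S by move=> St; apply: ub_le_sup => //; exact: hS.2.
have Sb : sup S <= b by apply: ge_sup => [|t []//]; exact: hS.1.
exists (sup S); split => //; first by apply: closed_bounded_sup => // t [].
  exact: leS.
apply/seteqP; split => t [Tt /andP[at_ tb]]; split; rewrite // at_ /=.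
  exact: leS.
exact: le_trans Sb.
Qed.

(** The condition on the shift by T is stated coordinatewise, hence is void in
    dimension zero, where constants have to solve the equation directly. *)
Lemma is_solution_dim0 (R : realType) (TS : set R) (a b : R)
    (D : set 'rV[R]_0) (f : R -> 'rV[R]_0 -> 'rV[R]_0) (x0 : 'rV[R]_0) :
  closed TS -> ~ has_ubound TS -> D x0 ->
  is_solution TS (ts_itv TS a b) D f (fun=> x0).
Proof.
move=> cTS uTS Dx0; split.
  by apply/within_continuousP => t _; exact: cvg_cst.
move=> t Jt [s [Js ts]]; split => //; rewrite [f t x0](_ : _ = 0) ?thinmx0//.
apply: is_delta_deriv_cst => //; first exact: ts_kappa_unbounded Jt.1.
exact: (fjump_itv cTS uTS Jt Js ts).
Qed.

Theorem theorem3 (R : realType) (n : nat)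
  (TS : set R) (hTS : time_scale TS) (hunb : ~ has_ubound TS)
  (Ts : set R) (t0 : R) (dp dm : R -> R -> R) (Dp Dm : R -> R -> Prop)
  (hshift : shift_operators TS Ts t0 dp dm Dp Dm)
  (hper : periodic_in_shifts Ts t0 Dp Dm)
  (P : R) (hP : is_shift_period Ts t0 Dp Dm P) (hPs : Ts P) (hP0 : t0 < P)
  (T : R) (hTs : Ts T) (hPT : P < T)
  (gamma : R)
  (D D' : set 'rV[R]_n) (hD' : D' `<=` D) (x0 : 'rV[R]_n) (hx0 : D' x0)
  (X : R -> 'rV[R]_n -> 'rV[R]_n)
  (ebar rho M lambda K : R) (xi : R -> R -> 'rV[R]_n)
  (hebar : 0 < ebar) (hrho : 0 < rho) (hM : 0 < M) (hlambda : 0 < lambda)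
  (hK : 0 < K)
  (* 1) *)
  (hquasi : forall x, D x -> forall j : 'I_n,
     geom_quasiperiodic TS Ts dp Dp Dm T gamma (fun t => X t x ord0 j))
  (* 2) *)
  (hrd : forall x, D x -> rd_continuous TS (fun t => X t x))
  (hreg : regressive TS D X)
  (hcauchy : forall eps, 0 < eps <= ebar ->
     cauchy_well_posed TS t0 D (fun t x => eps *: X t x))
  (hbound : forall t x, TS t -> D x -> `|X t x| <= M)
  (hlip : forall t x1 x2, TS t -> D x1 -> D x2 ->
     `|X t x1 - X t x2| <= lambda * `|x1 - x2|)
  (* 3) *)
  (hstep : forall i : nat, (1 <= i)%N ->
     shift_iter dp T t0 i.+1 - shift_iter dp T t0 i <= K)
  (* 4) *)
  (hxi : forall eps, 0 < eps <= ebar ->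
     [/\ xi eps t0 = x0,
         is_avg_solution TS dp T t0 gamma eps D X (xi eps) &
         forall t, TS t -> t0 <= t -> ball (xi eps t) rho `<=` D]) :
  forall L : R, 0 < L ->
  exists eps0 C : R, [/\ 0 < eps0, 0 < C &
    forall eps, 0 < eps < eps0 ->
      let J := ts_itv TS t0 (t0 + L * eps^-1) in
      let solves := fun x : R -> 'rV[R]_n =>
        x t0 = x0 /\ is_solution TS J D (fun t y => eps *: X t y) x in
      (exists x, solves x) /\
      (forall x, solves x -> forall t, J t -> `|x t - xi eps t| <= C * eps)].
Proof.
move=> L L0; have [cTS _] := hTS.
have t0T : t0 < T := lt_trans hP0 hPT.
have Tt0 : TS t0 := shift_subset hshift (shift_origin hshift).
case: n => [|n'] in D D' hD' x0 hx0 X xi hquasi hrd hreg hcauchy hbound hlip hxi *.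
  exists 1, 1; split => // eps /andP[eps0 _] J solves; split.
    exists (fun=> x0); split => //; apply: is_solution_dim0 => //; exact: hD'.
  move=> x _ t _; rewrite [x t - _](_ : _ = 0) ?thinmx0// normr0 mulr_ge0//.
  exact: ltW.
have Dx0 := hD' _ hx0; have [shift_dom _] := hquasi x0 Dx0 ord0.
(* The bound K starts at the second step; the first one has length T - t0. *)
pose K' := Num.max K (T - t0).
have K'0 : 0 < K' by rewrite lt_max hK.
have stepK' i : shift_iter dp T t0 i.+1 - shift_iter dp T t0 i <= K'.
  case: i => [|i]; rewrite le_max; last by rewrite hstep.
  have TT : TS T := shift_subset hshift hTs.
  by rewrite /shift_iter /= (shift_P3r hshift TT (ltW t0T)).2 lexx orbT.
pose C := 2 * M * K' * expR (lambda * L).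
have C0 : 0 < C by rewrite !mulr_gt0// expR_gt0.
exists (Num.min ebar (rho / C)), C; split => //.
  by rewrite lt_min hebar divr_gt0.
move=> eps /andP[eps0]; rewrite lt_min ltr_pdivlMr// => /andP[epse epsr] J solves.
have epsE : 0 < eps <= ebar by rewrite eps0 ltW.
have [xi0 xi_sol xi_ball] := hxi eps epsE.
have xi_in t : TS t -> t0 <= t -> D (xi eps t).
  by move=> Tt t0t; apply: (xi_ball t Tt t0t); exact: ballxx.
have estimate b x t : b <= t0 + L * eps^-1 -> x t0 = x0 ->
    is_solution TS (ts_itv TS t0 b) D (fun t y => eps *: X t y) x ->
    ts_itv TS t0 b t -> `|x t - xi eps t| <= C * eps.
  move=> bL xt0 solx Jt.
  exact: (averaging_estimate cTS hunb hshift t0T shift_dom hquasi hrd hM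
    hlambda K'0 hbound hlip stepK' eps0 xi_in xi_sol
    (etrans xt0 (esym xi0)) solx bL Jt).
have J0 : t0 <= t0 + L * eps^-1 by rewrite lerDl divr_ge0// ltW.
have [b1 [Tb1 t0b1 b1L JE]] := ts_itv_last cTS Tt0 J0.
rewrite /solves /J JE; split; last first.
  by move=> x [xt0 solx] t; exact: estimate.
apply: (ex_solution (f := fun t y => eps *: X t y) (c := eps * M)
  (lambda := eps * lambda)) => //.
- exact: mulr_gt0.
- exact: mulr_gt0.
- by move=> x Dx; apply: rd_continuousZ; exact: hrd.
- by move=> t x Tt Dx; rewrite normrZ gtr0_norm// ler_pM2l// hbound.
- move=> t x1 x2 Tt D1 D2; rewrite -scalerBr normrZ gtr0_norm// -mulrA ler_pM2l//.
  exact: hlip.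
- exact: hcauchy.
move=> b y Tb t0b bb1 y0 soly; have Jb : ts_itv TS t0 b b by split; rewrite ?t0b ?lexx.
have yb := estimate b y b (le_trans bb1 b1L) y0 soly Jb.
apply/nbhs_ballP; exists (rho - C * eps) => /=; first by rewrite subr_gt0 mulrC.
move=> v; rewrite -ball_normE /= => yv; apply: (xi_ball b Tb t0b).
rewrite -ball_normE /= -(subrKA (y b)) (le_lt_trans (ler_normD _ _))//.
by rewrite distrC in yb; lra.
Qed.
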